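(* Let $$\mathfrak{IV}=(A_1,F,\widetilde B,C,D,\widetilde D;\sigma_1,\sigma_2,\gamma,\sigma_{1*},\sigma_{2*},\gamma_*;\mathcal H_{t_2},\mathcal E,\mathcal E_*,\widetilde{\mathcal E},\widetilde{\mathcal E}_* ),$$ $$\breve{\mathfrak{IV}}=(\breve A_1,\breve F,\widetilde{\breve B},\breve C,\breve D,\breve{\widetilde D};\sigma_1,\sigma_2,\gamma,\sigma_{1*},\sigma_{2*},\gamma_*;\breve{\mathcal H}_{t_2},\mathcal E,\mathcal E_*,\widetilde{\mathcal E},\widetilde{\mathcal E}_* )$$ be two minimal integral vessels (with the same external data $\sigma_1,\sigma_2,\gamma,\sigma_{1*},\sigma_{2*},\gamma_*$ and external spaces), with transfer functions $S(\lambda,t_2)$ and $\breve S(\lambda,t_2)$. Then the vessels are gauge quasi-similar if and only if $S(\lambda,t_2)=\breve S(\lambda,t_2)$ (for all $t_2$) in a neighborhood of $\lambda=\infty$.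
   Context: Subscripts $*$ (as in $\sigma_{1*},\gamma_*,\mathcal E_*$) are part of the name and do not denote adjoints. ''Absolutely continuous'' and ''$L^1_{loc}$'' refer to the operator norm; absolutely continuous means on compact intervals. The variable $t_2$ ranges over $\mathbb R$. An (integral) vessel is a collection $$\mathfrak{IV}=(A_1(t_2),F(t_2,t_2^0),\widetilde B(t_2),C(t_2),D(t_2),\widetilde D(t_2);\sigma_1,\sigma_2,\gamma,\sigma_{1*},\sigma_{2*},\gamma_*;\mathcal H_{t_2},\mathcal E,\mathcal E_*,\widetilde{\mathcal E},\widetilde{\mathcal E}_* )$$ of Hilbert spaces and operator functions of $t_2$ with the following properties. (i) $F$ is an evolution semi-group: $F(t,s):\mathcal H_s\to\mathcal H_t$ is bounded and invertible, $F(r,s)F(s,t)=F(r,t)$, $F(t,t)=I$. (ii) $A_1(t_2):\mathcal H_{t_2}\to\mathcal H_{t_2}$, $\widetilde B(t_2):\widetilde{\mathcal E}\to\mathcal H_{t_2}$, $C(t_2):\mathcal H_{t_2}\to\mathcal E_*$ are bounded; for (almost) all $t$ the functions $s\mapsto F(t,s)\widetilde B(s)\sigma_1(s)$, $s\mapsto F(t,s)\widetilde B(s)\sigma_2(s)$, $s\mapsto C(s)F(s,t)$ are absolutely continuous. (iii) $D(t_2):\mathcal E\to\mathcal E_*$ and $\widetilde D(t_2):\widetilde{\mathcal E}\to\widetilde{\mathcal E}_*$ are absolutely continuous. (iv) $\sigma_2,\gamma\in L^1_{loc}$ with values in $\mathcal L(\mathcal E,\widetilde{\mathcal E})$; $\sigma_1(t_2)\in\mathcal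 L(\mathcal E,\widetilde{\mathcal E})$ is absolutely continuous with invertible values; likewise $\sigma_{2*},\gamma_*\in L^1_{loc}$ with values in $\mathcal L(\mathcal E_*,\widetilde{\mathcal E}_* )$ and $\sigma_{1*}(t_2)\in\mathcal L(\mathcal E_*,\widetilde{\mathcal E}_* )$ is absolutely continuous with invertible values. (v) The vessel conditions hold (those with derivatives for almost all $t_2$): $F(t_2,t_2^0)A_1(t_2^0)=A_1(t_2)F(t_2,t_2^0)$; $\frac{d}{dt_2}\big(F(t_2^0,t_2)\widetilde B\sigma_1\big)+F(t_2^0,t_2)A_1\widetilde B\sigma_2+F(t_2^0,t_2)\widetilde B\gamma=0$; $\sigma_{2*}CA_1F(t_2,t_2^0)-\sigma_{1*}\frac{d}{dt_2}[CF(t_2,t_2^0)]+\gamma_*CF(t_2,t_2^0)=0$; $\sigma_{1*}D=\widetilde D\sigma_1$, $\sigma_{2*}D=\widetilde D\sigma_2$, $\widetilde D\gamma=\sigma_{2*}C\widetilde B\sigma_1-\sigma_{1*}C\widetilde B\sigma_2-\sigma_{1*}\frac{dD}{dt_2}+\gamma_*D$. The transfer function of $\mathfrak{IV}$ is $S(\lambda,t_2)=D(t_2)+C(t_2)(\lambda I-A_1(t_2))^{-1}\widetilde B(t_2)\sigma_1(t_2)$, for $\lambda$ outside the ($t_2$-independent) spectrum of $A_1(t_2)$. Minimality: put $\widetilde{\mathcal C}_{t_2}=\operatorname{span}\{\operatorname{Im}F(t_2,s)A_1^j(s)\widetilde B(s)\mid j\ge 0,\ s\in\mathbb R\}$ (finite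 linear combinations) and $\widetilde{\mathcal O}^\perp_{t_2}=\bigcap_{n\ge0,\,s\in\mathbb R}\operatorname{Ker}C(s)A_1^n(s)F(s,t_2)$. The vessel is approximately controllable if $\widetilde{\mathcal C}_{t_2}$ is dense in $\mathcal H_{t_2}$, observable if $\widetilde{\mathcal O}^\perp_{t_2}=\{0\}$ (both properties do not depend on $t_2$), and minimal if it is both. Gauge quasi-similarity: two vessels $\mathfrak{IV}$, $\breve{\mathfrak{IV}}$ with the same external data and spaces and with $D=\breve D$, $\widetilde D=\breve{\widetilde D}$ are gauge quasi-similar if for each $t_2$ there is a (possibly unbounded) linear operator $T(t_2):D(T(t_2))\to\breve{\mathcal H}_{t_2}$ with dense domain $D(T(t_2))\subseteq\mathcal H_{t_2}$, one-to-one and with dense range, such that on $D(T(\cdot))$ (the domains being mapped so that all products make sense) $\breve A_1(t_2)T(t_2)=T(t_2)A_1(t_2)$, $\breve F(t_2,t_2^0)T(t_2^0)=T(t_2)F(t_2,t_2^0)$, $\widetilde{\breve B}(t_2)=T(t_2)\widetilde B(t_2)$, $\breve C(t_2)T(t_2)=C(t_2)$, and moreover $\widetilde{\mathcal C}_{t_2}\subseteq D(T(t_2))$ and $F(t_2,t_2^0)D(T(t_2^0))\subseteq D(T(t_2))$. *)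

(* Defs.v *)
From HB Require Import structures.
From mathcomp Require Import all_boot all_order all_algebra.
From mathcomp Require Import complex.
From mathcomp Require Import all_classical all_reals all_analysis.

Set Implicit Arguments.
Unset Strict Implicit.
Unset Printing Implicit Defensive.

Import Order.TTheory GRing.Theory Num.Theory.
Import numFieldNormedType.Exports.

Local Open Scope classical_set_scope.
Local Open Scope ring_scope.

HB.mixin Record CompleteNormedModule_isHilbert (R : realType) H
    of CompleteNormedModule R[i] H := {
  inner : H -> H -> R[i] ;
  inner_linear : forall (a : R[i]) (x y z : H),
    inner (a *: x + y) z = a * inner x z + inner y z ;
  inner_conj : forall x y : H, inner y x = (inner x y)^* ;
  inner_norm : forall x : H, inner x x = `|x| ^+ 2
}.

#[short(type="hilbertType")]
HB.structure Definition Hilbert (R : realType) :=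
  { H of CompleteNormedModule_isHilbert R H & CompleteNormedModule R[i] H }.

Section Operators.
Context {R : realType}.
Implicit Types E F H : hilbertType R.

Definition bounded_op E F (T : E -> F) : Prop := linear T /\ continuous T.

(* The norm of a normed module over [R[i]] takes (real) values in [R[i]], hence
   the real part. If T is not bounded then [opnorm T] is the junk value of
   [sup]; below it is only applied to bounded operators. *)
Definition opnorm E F (T : E -> F) : R :=
  sup [set complex.Re `|T x| | x in [set x : E | `|x| <= 1]].

Definition is_inverse_op E F (T : E -> F) (S : F -> E) : Prop :=
  [/\ bounded_op S, cancel T S & cancel S T].

Definition invertible_op E F (T : E -> F) : Prop :=
  bounded_op T /\ exists S, is_inverse_op T S.

Definition resolvent_set H (A : H -> H) : set R[i] :=
  [set lambda | invertible_op (fun x => lambda *: x - A x)].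

(* (lambda I - A)^-1, and the zero map if lambda is in the spectrum of A *)
Definition resolvent H (A : H -> H) (lambda : R[i]) : H -> H :=
  xget (fun=> 0) [set S | is_inverse_op (fun x => lambda *: x - A x) S].

Definition op_abs_cont E F (f : R -> E -> F) : Prop :=
  forall a b e : R, 0 < e -> exists2 d : R, 0 < d &
    forall (n : nat) (x y : 'I_n -> R),
      (forall i, a <= x i /\ x i <= y i /\ y i <= b) ->
      trivIset [set: 'I_n] (fun i => `]x i, y i[%classic) ->
      \sum_(i < n) (y i - x i) < d ->
      \sum_(i < n) opnorm (f (y i) - f (x i)) < e.

Definition is_op_derive E F (f : R -> E -> F) (t : R) (L : E -> F) : Prop :=
  bounded_op L /\
  opnorm ((h%:C)%C^-1 *: (f (t + h) - f t) - L) @[h --> 0^'] --> (0 : R).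

Definition op_simple E F (g : R -> E -> F) : Prop :=
  [/\ forall t, bounded_op (g t), finite_set (range g)
    & forall T : E -> F, measurable (g @^-1` [set T])].

(* Bochner measurability: an almost everywhere limit, in operator norm, of
   simple functions *)
Definition op_strongly_measurable E F (f : R -> E -> F) : Prop :=
  exists2 g : nat -> R -> E -> F, forall n, op_simple (g n) &
    {ae @lebesgue_measure R, forall t, opnorm (g n t - f t) @[n --> \oo] --> (0 : R)}.

(* By strong measurability, the norm of f agrees almost everywhere with a Borel
   function. The library's integral of a nonnegative function is a supremum over
   simple functions below it, so it does not see null sets and is the Lebesgue
   integral here even if the norm of f itself is not Borel. *)
Definition op_L1loc E F (f : R -> E -> F) : Prop :=
  [/\ forall t, bounded_op (f t), op_strongly_measurable f
    & forall a b : R,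
        (\int[@lebesgue_measure R]_(t in `[a, b]) (opnorm (f t))%:E < +oo)%E].

Definition submodule H (S : set H) : Prop :=
  S 0 /\ forall (a : R[i]) x y, S x -> S y -> S (a *: x + y).

Definition linear_span H (S : set H) : set H :=
  [set x | exists n (a : 'I_n -> R[i]) (v : 'I_n -> H),
     (forall i, S (v i)) /\ x = \sum_(i < n) a i *: v i].

End Operators.

Unset Implicit Arguments.

(* A letter s appended to a name stands for a lower star, a letter t for a
   tilde; e.g. [spEst] is the space E_* with a tilde. In a vessel, [vB] is B with a
   tilde, [vD] is D and [vDt] is D with a tilde. *)
Record external_data (R : realType) := ExternalData {
  spE : hilbertType R ;
  spEs : hilbertType R ;
  spEt : hilbertType R ;
  spEst : hilbertType R ;
  sigma1 : R -> spE -> spEt ;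
  sigma2 : R -> spE -> spEt ;
  gamma : R -> spE -> spEt ;
  sigma1s : R -> spEs -> spEst ;
  sigma2s : R -> spEs -> spEst ;
  gammas : R -> spEs -> spEst ;

  sigma1_invertible : forall t, invertible_op (sigma1 t) ;
  sigma1_abs_cont : op_abs_cont sigma1 ;
  sigma2_L1loc : op_L1loc sigma2 ;
  gamma_L1loc : op_L1loc gamma ;
  sigma1s_invertible : forall t, invertible_op (sigma1s t) ;
  sigma1s_abs_cont : op_abs_cont sigma1s ;
  sigma2s_L1loc : op_L1loc sigma2s ;
  gammas_L1loc : op_L1loc gammas
}.

Arguments spE {R} e.
Arguments spEs {R} e.
Arguments spEt {R} e.
Arguments spEst {R} e.
Arguments sigma1 {R} e t x.
Arguments sigma2 {R} e t x.
Arguments gamma {R} e t x.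
Arguments sigma1s {R} e t x.
Arguments sigma2s {R} e t x.
Arguments gammas {R} e t x.

Record vessel (R : realType) (X : external_data R) := Vessel {
  vH : R -> hilbertType R ;
  vA : forall t, vH t -> vH t ;
  vF : forall t s, vH s -> vH t ;
  vB : forall t, spEt X -> vH t ;
  vC : forall t, vH t -> spEs X ;
  vD : R -> spE X -> spEs X ;
  vDt : R -> spEt X -> spEst X ;

  vF_invertible : forall t s, invertible_op (vF t s) ;
  vF_comp : forall r s t x, vF r s (vF s t x) = vF r t x ;
  vF_id : forall t x, vF t t x = x ;

  vA_bounded : forall t, bounded_op (vA t) ;
  vB_bounded : forall t, bounded_op (vB t) ;
  vC_bounded : forall t, bounded_op (vC t) ;
  vFB_sigma1_abs_cont : {ae @lebesgue_measure R, forall t,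
    op_abs_cont (fun s u => vF t s (vB s (sigma1 X s u)))} ;
  vFB_sigma2_abs_cont : {ae @lebesgue_measure R, forall t,
    op_abs_cont (fun s u => vF t s (vB s (sigma2 X s u)))} ;
  vCF_abs_cont : {ae @lebesgue_measure R, forall t,
    op_abs_cont (fun s x => vC s (vF s t x))} ;

  vD_bounded : forall t, bounded_op (vD t) ;
  vD_abs_cont : op_abs_cont vD ;
  vDt_bounded : forall t, bounded_op (vDt t) ;
  vDt_abs_cont : op_abs_cont vDt ;

  vessel_Lax : forall t t0 x, vF t t0 (vA t0 x) = vA t (vF t t0 x) ;
  vessel_input : forall t0, {ae @lebesgue_measure R, forall t,
    exists2 G' : spE X -> vH t0,
      is_op_derive (fun s u => vF t0 s (vB s (sigma1 X s u))) t G' &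
      forall u, G' u + vF t0 t (vA t (vB t (sigma2 X t u)))
                  + vF t0 t (vB t (gamma X t u)) = 0} ;
  vessel_output : forall t0, {ae @lebesgue_measure R, forall t,
    exists2 G' : vH t0 -> spEs X,
      is_op_derive (fun s x => vC s (vF s t0 x)) t G' &
      forall x, sigma2s X t (vC t (vA t (vF t t0 x))) - sigma1s X t (G' x)
                  + gammas X t (vC t (vF t t0 x)) = 0} ;
  vessel_linkage1 : forall t u, sigma1s X t (vD t u) = vDt t (sigma1 X t u) ;
  vessel_linkage2 : forall t u, sigma2s X t (vD t u) = vDt t (sigma2 X t u) ;
  vessel_linkage_gamma : {ae @lebesgue_measure R, forall t,
    exists2 D' : spE X -> spEs X,
      is_op_derive vD t D' &
      forall u, vDt t (gamma X t u) =
        sigma2s X t (vC t (vB t (sigma1 X t u)))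
        - sigma1s X t (vC t (vB t (sigma2 X t u)))
        - sigma1s X t (D' u) + gammas X t (vD t u)}
}.

Arguments vH {R X} v t.
Arguments vA {R X} v t x.
Arguments vF {R X} v t s x.
Arguments vB {R X} v t x.
Arguments vC {R X} v t x.
Arguments vD {R X} v t x.
Arguments vDt {R X} v t x.

Section VesselNotions.
Context {R : realType} {X : external_data R}.

Definition transfer_function (V : vessel R X) (lambda : R[i]) (t : R)
    : spE X -> spEs X :=
  fun u => vD V t u
           + vC V t (resolvent (vA V t) lambda (vB V t (sigma1 X t u))).

Definition controllable_space (V : vessel R X) (t : R) : set (vH V t) :=
  linear_span [set x | exists (j : nat) (s : R) (v : spEt X),
                         x = vF V t s (iter j (vA V s) (vB V s v))].

Definition unobservable_space (V : vessel R X) (t : R) : set (vH V t) :=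
  [set x | forall (n : nat) (s : R),
             vC V s (iter n (vA V s) (vF V s t x)) = 0].

Definition approximately_controllable (V : vessel R X) : Prop :=
  forall t, dense (controllable_space V t).

Definition observable (V : vessel R X) : Prop :=
  forall t, unobservable_space V t = [set 0].

Definition minimal (V : vessel R X) : Prop :=
  approximately_controllable V /\ observable V.

(* The operator T(t) is represented by its domain [dom t] and a total map
   [T t], whose values outside [dom t] are irrelevant. The clauses
   [dom t (vA V t x)] and [dom t (vF V t s x)], together with the inclusion of
   the controllable space (which contains the range of [vB V t]), make the
   products in the intertwining relations well defined. *)
Definition gauge_quasi_similar (V W : vessel R X) : Prop :=
  [/\ vD V = vD W,
      vDt V = vDt W
    & exists (dom : forall t, set (vH V t)) (T : forall t, vH V t -> vH W t),
      [/\ forall t,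
            [/\ submodule (dom t),
                forall (a : R[i]) x y, dom t x -> dom t y ->
                  T t (a *: x + y) = a *: T t x + T t y,
                dense (dom t),
                set_inj (dom t) (T t)
              & dense (T t @` dom t)],
          forall t x, dom t x ->
            dom t (vA V t x) /\ vA W t (T t x) = T t (vA V t x),
          forall t s x, dom s x ->
            dom t (vF V t s x) /\ vF W t s (T s x) = T t (vF V t s x),
          forall t, controllable_space V t `<=` dom t /\
            (forall v, vB W t v = T t (vB V t v))
        & forall t x, dom t x -> vC W t (T t x) = vC V t x]].

Definition transfer_functions_agree_near_infinity (V W : vessel R X) : Prop :=
  exists rho : R, forall lambda : R[i], (rho%:C)%C < `|lambda| -> forall t : R,
    [/\ resolvent_set (vA V t) lambda,
        resolvent_set (vA W t) lambda
      & transfer_function V lambda t = transfer_function W lambda t].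

End VesselNotions.

(* Main.v *)
From HB Require Import structures.
Require Import Defs.
From mathcomp Require Import all_boot all_order all_algebra.
From mathcomp Require Import complex.
From mathcomp Require Import all_classical all_reals all_analysis.
From mathcomp Require Import measurable_realfun.
From mathcomp Require Import ring lra.

Set Implicit Arguments.
Unset Strict Implicit.
Unset Printing Implicit Defensive.

Import Order.TTheory GRing.Theory Num.Theory.
Import numFieldNormedType.Exports.

Local Open Scope classical_set_scope.
Local Open Scope ring_scope.

(** Write [m_k(t) = C(t) A(t)^k B(t)] for the moments of a vessel (B stands for
    B with a tilde).  For minimal vessels, both properties are equivalent to: the
    two vessels have the same [D] and the same moments for all [k] and [t].

    Transfer functions and moments.  From
    [lambda C A^k R = C A^k + C A^(k+1) R], with [R] the resolvent at [lambda], the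
    differences of the two vessels satisfy simple recursions.  If the transfer
    functions agree, letting [lambda] tend to infinity along the reals removes one
    term after the other: first [D], then [m_0], [m_1], ...
    ([moments_of_resolvents]).  If the moments agree, the difference of the
    [C A^k R B] is [lambda^k] times the difference of the [C R B] and is bounded
    by a multiple of [c^k], where [c] bounds the norms of both operators [A]; for
    [|lambda| > c] it must vanish ([resolvents_of_moments]).  As [A(t)] is
    conjugate to [A(0)] by [F], one radius serves all [t].

    Moments and quasi-similarity.  A quasi-similarity intertwines all data, so it
    preserves the moments.  Conversely, call [x] and [y] in the two state spaces at
    [t] indistinguishable if [C(s) A(s)^k F(s,t)] gives the same value on both for
    all [k] and [s].  Observability makes this relation single-valued in both
    directions, and it is compatible with [A], [F], [C] and linear combinations; so
    it is the graph of the required injective operator, provided it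
    relates the generators [F(t,r) A(r)^j B(r) v] of the controllable spaces to each
    other, and then approximate controllability gives dense domain and range.
    That these generators correspond says that the functions [C(s) F(s,r) A(r)^k B(r)] of two time
    variables agree for both vessels, whereas the moments only give [s = r].

    From one time to two times.  For fixed [r], the differences [h_k(s)] of
    these functions satisfy
    [sigma1s h_k' = sigma2s h_(k+1) + gammas h_k] for almost all [s], are
    [O(c^k)], and vanish at [s = r].  Hence [N(s) = sup_k |h_k(s)| / c^k] is
    absolutely continuous and [|N'| <= K (c |sigma2s| + |gammas|) N] locally, almost
    everywhere, with an integrable factor in front of [N]; so [N] is zero near each
    of its zeros, the zero set is open, closed and nonempty, and [N] vanishes
    identically ([output_hierarchy_unique]).  The integral inequality behind this
    is [abs_cont_growth], a mean value inequality for absolutely continuous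
    functions whose hypothesis holds almost everywhere. *)

(** * Real-valued norms *)

Section RealNorm.
Context {R : realType}.

(** Norms over [R[i]] take values in [R[i]]; passing to the real part once makes
    the ordered field [R] available for all estimates. *)
Definition nrm (V : normedZmodType R[i]) (x : V) : R := complex.Re `|x|.

Lemma nrmE (V : normedZmodType R[i]) (x : V) : `|x| = (nrm x)%:C%C.
Proof.
have := normr_ge0 x; rewrite lecE /= => /andP[/eqP h _].
by rewrite /nrm; move: h; case: (`|x|) => a b /= ->.
Qed.

Lemma nrm_ge0 (V : normedZmodType R[i]) (x : V) : 0 <= nrm x.
Proof. by have := normr_ge0 x; rewrite nrmE lecR. Qed.

Lemma nrm0 (V : normedZmodType R[i]) : nrm (0 : V) = 0.
Proof. by rewrite /nrm normr0. Qed.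

Lemma nrm_eq0 (V : normedZmodType R[i]) (x : V) : nrm x = 0 -> x = 0.
Proof. by move=> h; apply/normr0_eq0; rewrite nrmE h. Qed.

Lemma nrmN (V : normedZmodType R[i]) (x : V) : nrm (- x) = nrm x.
Proof. by rewrite /nrm normrN. Qed.

Lemma nrmD (V : normedZmodType R[i]) (x y : V) : nrm (x + y) <= nrm x + nrm y.
Proof.
have := ler_normD x y; rewrite !nrmE.
by rewrite -[leRHS](rmorphD (real_complex R)) lecR.
Qed.

Lemma nrmB (V : normedZmodType R[i]) (x y : V) : nrm (x - y) <= nrm x + nrm y.
Proof. by rewrite -(nrmN y) nrmD. Qed.

Lemma nrm_distC (V : normedZmodType R[i]) (x y : V) : nrm (x - y) = nrm (y - x).
Proof. by rewrite -nrmN opprB. Qed.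

Lemma nrmZ (V : normedModType R[i]) (a : R[i]) (x : V) :
  nrm (a *: x) = nrm a * nrm x.
Proof.
by apply: (@complexI R); rewrite rmorphM/= -!nrmE normrZ.
Qed.

Lemma nrmC (a : R) : nrm (a%:C%C : R[i]) = `|a|.
Proof. by rewrite /nrm normc_def/= expr0n /= addr0 sqrtr_sqr. Qed.

Lemma nrmM (a b : R[i]) : nrm (a * b) = nrm a * nrm b.
Proof. by apply: (@complexI R); rewrite rmorphM/= -!nrmE normrM. Qed.

Lemma nrm1 : nrm (1 : R[i]) = 1.
Proof. by rewrite /nrm normr1. Qed.

Lemma nrmV (a : R[i]) : nrm a^-1 = (nrm a)^-1.
Proof.
have [->|a0] := eqVneq a 0; first by rewrite invr0 nrm0 invr0.
have na : nrm a != 0 by apply/eqP => /nrm_eq0 /eqP; exact/negP.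
by apply: (mulIf na); rewrite mulVf// -nrmM mulVf// nrm1.
Qed.

End RealNorm.

(** * Bounded operators *)

Section BoundedOperators.
Context {R : realType}.
Implicit Types E F G H : hilbertType R.

Lemma bounded_opP E F (T : E -> F) : bounded_op T <->
  linear T /\ exists2 M, 0 <= M & forall x, nrm (T x) <= M * nrm x.
Proof.
split=> [[linT cT]|[linT [M M0 TM]]]; split=> //.
- pose T' : {linear E -> F} :=
    HB.pack T (GRing.isLinear.Build _ _ _ _ T linT).
  have /linear_boundedP/pinfty_ex_gt0[m m0 Hm] : bounded_near T' (nbhs 0).
    by apply: continuous_linear_bounded; exact: (cT 0).
  have mE : m = (complex.Re m)%:C%C.
    by move: m0; rewrite ltcE /= => /andP[/eqP]; case: (m) => a b /= ->.
  exists (complex.Re m) => [|x].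
    by move: m0; rewrite {1}mE (ltcR 0) => /ltW.
  have := Hm x; rewrite !nrmE mE.
  by rewrite -[X in _ <= X](rmorphM (real_complex R)) lecR.
- pose T' : {linear E -> F} :=
    HB.pack T (GRing.isLinear.Build _ _ _ _ T linT).
  suff : bounded_near T' (nbhs 0) by apply: bounded_linear_continuous.
  apply/linear_boundedP; exists M%:C%C; split.
    by rewrite realE (lecR 0) M0.
  move=> r Mr x; rewrite (le_trans _ (ler_wpM2r (normr_ge0 x) (ltW Mr)))//.
  by rewrite !nrmE -[X in _ <= X](rmorphM (real_complex R)) lecR.
Qed.

Lemma op_linear0 E F (T : E -> F) : linear T -> T 0 = 0.
Proof.
by move=> /(_ (-1) 0 0); rewrite scaler0 addr0 scaleN1r addNr.
Qed.

Lemma op_linearB E F (T : E -> F) : linear T ->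
  forall x y, T (x - y) = T x - T y.
Proof.
move=> linT x y; have := linT (-1) y x.
by rewrite !scaleN1r [X in T X]addrC => ->; rewrite addrC.
Qed.

Lemma op_linearD E F (T : E -> F) : linear T ->
  forall x y, T (x + y) = T x + T y.
Proof. by move=> linT x y; have := linT 1 x y; rewrite !scale1r. Qed.

Lemma op_linearZ E F (T : E -> F) : linear T ->
  forall a x, T (a *: x) = a *: T x.
Proof.
by move=> linT a x; have := linT a x 0; rewrite !addr0 (op_linear0 linT) addr0.
Qed.

Lemma opnorm_lub E F (T : E -> F) (M : R) : T 0 = 0 ->
  (forall x, nrm (T x) <= M * nrm x) -> 0 <= M -> opnorm T <= M.
Proof.
move=> T0 TM M0; apply: sup_le_ub.
  by exists 0; exists 0 => /=; rewrite ?normr0 ?T0 ?normr0.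
move=> _ [x /= x1 <-]; apply: (le_trans (TM x)).
by rewrite ler_piMr//; move: x1; rewrite nrmE (lecR _ 1).
Qed.

Lemma opnorm_has_sup E F (T : E -> F) : bounded_op T ->
  has_sup [set complex.Re `|T x| | x in [set x : E | `|x| <= 1]].
Proof.
move=> /bounded_opP[linT [M M0 TM]]; split.
  by exists (nrm (T 0)), 0 => //=; rewrite normr0.
exists M => _ [x /= x1 <-]; apply: (le_trans (TM x)).
by rewrite ler_piMr//; move: x1; rewrite nrmE (lecR _ 1).
Qed.

Lemma opnorm_ge0 E F (T : E -> F) : bounded_op T -> 0 <= opnorm T.
Proof.
move=> bT; have [_ ubT] := opnorm_has_sup bT.
by apply: (le_trans (nrm_ge0 (T 0))); apply: ub_le_sup => //; exists 0 => //=;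
  rewrite normr0.
Qed.

Lemma opnorm_le E F (T : E -> F) : bounded_op T ->
  forall x, nrm (T x) <= opnorm T * nrm x.
Proof.
move=> bT x; have [_ ubT] := opnorm_has_sup bT; have [linT _] := bT.
have [x0|x0] := eqVneq (nrm x) 0.
  by rewrite (nrm_eq0 x0) (op_linear0 linT) !nrm0 mulr0.
have nx : 0 < nrm x by rewrite lt_neqAle eq_sym x0 nrm_ge0.
rewrite -ler_pdivrMr//; apply: ub_le_sup => //.
exists ((nrm x)^-1%:C%C *: x).
  by rewrite /= nrmE nrmZ nrmC ger0_norm ?invr_ge0 ?nrm_ge0// mulVf.
rewrite -/(nrm _) (op_linearZ linT) nrmZ nrmC ger0_norm ?invr_ge0 ?nrm_ge0//.
by rewrite mulrC.
Qed.

Lemma bounded_opD E F (S T : E -> F) :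
  bounded_op S -> bounded_op T -> bounded_op (S + T).
Proof.
move=> /bounded_opP[lS [m m0 Sm]] /bounded_opP[lT [n n0 Tn]].
apply/bounded_opP; split=> [a x y|].
  by rewrite !fctE lS lT scalerDr addrACA.
exists (m + n) => [|x]; first exact: addr_ge0.
by rewrite fctE mulrDl (le_trans (nrmD _ _))// lerD.
Qed.

Lemma bounded_opZ E F (T : E -> F) (a : R[i]) :
  bounded_op T -> bounded_op (a *: T).
Proof.
move=> /bounded_opP[lT [n n0 Tn]].
apply/bounded_opP; split=> [b x y|].
  by rewrite !fctE lT scalerDr !scalerA mulrC.
exists (nrm a * n) => [|x]; first by rewrite mulr_ge0 ?nrm_ge0.
by rewrite fctE nrmZ -mulrA ler_wpM2l ?nrm_ge0.
Qed.

Lemma bounded_opB E F (S T : E -> F) :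
  bounded_op S -> bounded_op T -> bounded_op (S - T).
Proof.
by move=> bS bT; rewrite -(scaleN1r T); apply/bounded_opD/bounded_opZ.
Qed.

Lemma opnorm_distC E F (S T : E -> F) : opnorm (S - T) = opnorm (T - S).
Proof. by congr sup; apply: eq_imagel => x _; exact: nrm_distC. Qed.

Lemma bounded_op_comp E F G (S : F -> G) (T : E -> F) :
  bounded_op S -> bounded_op T -> bounded_op (S \o T).
Proof.
move=> /bounded_opP[lS [m m0 Sm]] /bounded_opP[lT [n n0 Tn]].
apply/bounded_opP; split=> [a x y|]; first by rewrite /= lT lS.
exists (m * n) => [|x]; first exact: mulr_ge0.
by rewrite (le_trans (Sm _))// -mulrA ler_wpM2l.
Qed.

Lemma opnorm_comp_le E F G (S : F -> G) (T : E -> F) :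
  bounded_op S -> bounded_op T -> opnorm (S \o T) <= opnorm S * opnorm T.
Proof.
move=> bS bT; apply: opnorm_lub.
- by rewrite /= (op_linear0 bT.1) (op_linear0 bS.1).
- move=> x; rewrite (le_trans (opnorm_le bS _))// -mulrA.
  by rewrite ler_wpM2l ?opnorm_ge0 ?opnorm_le.
- by rewrite mulr_ge0 ?opnorm_ge0.
Qed.

Lemma nrm_iter_le H (A : H -> H) (c : R) (x : H) (n : nat) : 0 <= c ->
  (forall y, nrm (A y) <= c * nrm y) -> nrm (iter n A x) <= c ^+ n * nrm x.
Proof.
move=> c0 Ac; elim: n => [|n IH] /=; first by rewrite mul1r.
by rewrite (le_trans (Ac _))// exprS -mulrA ler_wpM2l.
Qed.

End BoundedOperators.

(** * A mean value inequality for absolutely continuous functions *)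

Section AbsolutelyContinuousGrowth.
Context {R : realType}.
Local Notation mu := (@lebesgue_measure R).

(** The scalar form, on one interval, of [op_abs_cont]. *)
Definition abs_cont_on (a b : R) (f : R -> R) : Prop :=
  forall e : R, 0 < e -> exists2 d : R, 0 < d &
    forall (n : nat) (x y : 'I_n -> R),
      (forall i, a <= x i /\ x i <= y i /\ y i <= b) ->
      trivIset [set: 'I_n] (fun i => `]x i, y i[%classic) ->
      \sum_(i < n) (y i - x i) < d ->
      \sum_(i < n) `|f (y i) - f (x i)| < e.

Lemma trivIset_ord1 (x y : 'I_1 -> R) :
  trivIset [set: 'I_1] (fun i => `]x i, y i[%classic).
Proof. by move=> i j _ _ _; rewrite (ord1 i) (ord1 j). Qed.

Lemma abs_cont_on_continuous (f : R -> R) :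
  (forall a b, abs_cont_on a b f) -> continuous f.
Proof.
move=> acf t; apply/cvgrPdist_lt => e e0.
have [d d0 Hd] := acf (t - 1) (t + 1) e e0.
apply/nbhs_ballP; exists (Num.min d 1) => /=; first by rewrite lt_min d0 ltr01.
move=> s; rewrite /ball/= distrC lt_min => /andP[sd].
rewrite ltr_norml => /andP[s1 s1'].
have [st|/ltW ts] := leP t s.
  have := Hd 1%N (fun=> t) (fun=> s).
  rewrite !big_ord1 distrC; apply; [by move=> _; split; lra|exact: trivIset_ord1|].
  by rewrite -[ltLHS]ger0_norm// subr_ge0.
have := Hd 1%N (fun=> s) (fun=> t).
rewrite !big_ord1; apply; [by move=> _; split; lra|exact: trivIset_ord1|].
by rewrite -[ltLHS]ger0_norm ?subr_ge0// distrC.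
Qed.

(** Cousin's compactness lemma in the straddling form: a property that is additive
    on adjacent intervals and holds on all small intervals around each point holds
    on the whole interval.  The supremum of the good right end points is itself
    good, and could be moved further right. *)
Lemma cousin (a b : R) (P : R -> R -> Prop) : a <= b ->
  (forall x y z, x <= y -> y <= z -> P x y -> P y z -> P x z) ->
  (forall t, a <= t -> t <= b -> exists2 d, 0 < d &
     forall x y, a <= x -> x <= t -> t <= y -> y <= b ->
       t - x < d -> y - t < d -> P x y) ->
  P a b.
Proof.
move=> ab Ptr Ploc; pose S := [set t | a <= t /\ t <= b /\ P a t].
have Sa : S a.
  split=> //; split=> //; have [d d0 Hd] := Ploc a (lexx a) ab.
  by apply: Hd => //; rewrite subrr.
have ubS : ubound S b by move=> t [_ []].
have supS : has_sup S by split; [exists a|exists b].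
have aT : a <= sup S by apply: ub_le_sup => //; exists b.
have Tb : sup S <= b by apply: sup_le_ub => //; exists a.
have [d d0 Hd] := Ploc _ aT Tb.
have [t St tT] := sup_adherent d0 supS.
have tleT : t <= sup S by apply: ub_le_sup => //; exists b.
pose y := Num.min b (sup S + d / 2).
have Ty : sup S <= y by rewrite le_min Tb lerDl divr_ge0// ltW.
have yb : y <= b by rewrite ge_min lexx.
have [at_ [_ Pat]] := St.
have Pay : P a y.
  apply: (Ptr a t y) => //; first exact: le_trans tleT Ty.
  apply: Hd => //; first lra.
  have : y <= sup S + d / 2 by rewrite ge_min lexx orbT.
  lra.
have : y <= sup S.
  by apply: ub_le_sup; [exists b|split=> //; exact: le_trans Ty].
rewrite ge_min => /orP[bT|]; last lra.
by move: Pay; rewrite (_ : y = b)//; apply/eqP; rewrite eq_le yb (le_trans bT).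
Qed.

(** The finitely many non-overlapping subintervals, collected while walking from
    [x] to [y], on which absolute continuity (rather than the growth bound) will
    be used; [U] is an open neighbourhood of the exceptional null set. *)
Definition interval_chain (U : set R) (x y : R) (s : seq (R * R)) : Prop :=
  pairwise (fun p q => p.2 <= q.1) s /\
  forall p, p \in s ->
    [/\ x <= p.1, p.1 <= p.2, p.2 <= y & `[p.1, p.2]%classic `<=` U].

Lemma interval_chain_cat U x y z s1 s2 : x <= y -> y <= z ->
  interval_chain U x y s1 -> interval_chain U y z s2 ->
  interval_chain U x z (s1 ++ s2).
Proof.
move=> xy yz [p1 h1] [p2 h2]; split.
  rewrite pairwise_cat p1 p2 !andbT; apply/allrelP => p q ps qs.
  by have [_ _ h _] := h1 _ ps; have [h' _ _ _] := h2 _ qs; exact: le_trans h h'.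
move=> p; rewrite mem_cat => /orP[/h1[]|/h2[]] ? ? ? ?; split=> //.
- exact: le_trans yz.
- exact: le_trans xy _.
Qed.

Lemma interval_chain_trivIset U x y s : interval_chain U x y s ->
  trivIset [set: 'I_(size s)]
    (fun i => `](nth (0, 0) s i).1, (nth (0, 0) s i).2[%classic).
Proof.
move=> [/(pairwiseP (0, 0)) ps _] i j _ _ [z []] /=.
rewrite !in_itv /= => /andP[iz zi] /andP[jz zj].
apply/val_inj/eqP; rewrite eqn_leq; apply/andP; split; rewrite leqNgt;
  apply/negP => ij; have := ps _ _ (ltn_ord _) (ltn_ord _) ij => /= h.
- by have := lt_trans (lt_le_trans zj h) iz; rewrite ltxx.
- by have := lt_trans (lt_le_trans zi h) jz; rewrite ltxx.
Qed.

Lemma interval_chain_length U x y s : measurable U -> interval_chain U x y s ->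
  ((\sum_(i < size s) ((nth (0, 0) s i).2 - (nth (0, 0) s i).1))%:E <= mu U)%E.
Proof.
move=> mU cs; have tI := interval_chain_trivIset cs.
have hs i (si : (i < size s)%N) := cs.2 _ (mem_nth (0, 0) si).
have /= := @measure_bigsetU_ord _ _ _ mu (size s) predT _
  (fun i => measurable_itv _) tI.
rewrite -sumEFin => E.
rewrite [leLHS](_ : _ = mu (\big[setU/set0]_(i < size s)
   `](nth (0, 0) s i).1, (nth (0, 0) s i).2[%classic)).
  apply: le_measure; rewrite ?inE//.
    by apply: bigsetU_measurable => i _; exact: measurable_itv.
  rewrite -(bigcup_mkord _
    (fun i => `](nth (0, 0) s i).1, (nth (0, 0) s i).2[%classic)).
  move=> z [i /= si zi].
  have [_ _ _] := hs _ si; apply; move: zi => /=.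
  by rewrite !in_itv/= => /andP[/ltW -> /ltW ->].
rewrite E; apply: eq_bigr => i _; rewrite lebesgue_measure_itv/= lte_fin.
have [_ h _ _] := hs _ (ltn_ord i).
case: ltP => // h'.
by congr EFin; apply/eqP; rewrite subr_eq0 eq_le h h'.
Qed.

(** Cover the exceptional null set by an open set [U] of small measure.  Around a
    point of [U], charge the increment of [f] to the interval itself; around any
    other point use the hypothesis.  By [cousin] the whole increment is at most
    that of [Phi], plus [e], plus the variation of [f] on finitely many disjoint
    intervals inside [U], which absolute continuity makes small. *)
Lemma abs_cont_growth (a b : R) (f Phi : R -> R) : a <= b ->
  abs_cont_on a b f ->
  (forall x y, a <= x -> x <= y -> y <= b -> Phi x <= Phi y) ->
  {ae mu, forall t, a <= t -> t <= b -> forall e, 0 < e -> exists2 d, 0 < d &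
     forall x y, a <= x -> x <= t -> t <= y -> y <= b ->
       t - x < d -> y - t < d ->
       `|f y - f x| <= Phi y - Phi x + e * (y - x)} ->
  `|f b - f a| <= Phi b - Phi a.
Proof.
move=> ab acf ndPhi [E [mE muE0 subE]]; apply/ler_addgt0Pr => e e0.
(* The slack [e] is shared: half for the slopes, half for the set [U]. *)
pose e1 := e / (2 * (b - a + 1)).
have ba0 : 0 <= b - a by rewrite subr_ge0.
have le_of_eq (x y : \bar R) : x = y -> (x <= y)%E by move=> ->.
have E0 : (lebesgue_measure E = 0)%E by exact: muE0.
have e10 : 0 < e1 by rewrite divr_gt0// mulr_gt0//; lra.
have [d d0 Hd] := acf _ (divr_gt0 e0 (ltr0Sn R 1)).
have [U [oU EU Ud]] :
  exists U : set R, [/\ open U, E `<=` U & (mu (U `\` E) < d%:E)%E].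
  by apply: lebesgue_regularity_outer => //;
     apply: (@le_lt_trans _ _ 0%E) => //; exact: le_of_eq E0.
have mU : measurable U by exact: open_measurable.
have muU : (mu U < d%:E)%E.
  rewrite (le_lt_trans _ Ud)// -(adde0 (mu (U `\` E))).
  rewrite -{1}(setDUK EU) setUC.
  apply: (le_trans (measureU2 _ _ _)) => //; first exact: measurableD.
  by apply: leeD => //; exact: le_of_eq E0.
pose good x y := exists2 s, interval_chain U x y s &
  `|f y - f x| <= \sum_(p <- s) `|f p.2 - f p.1| + (Phi y - Phi x)
                  + e1 * (y - x).
have [s cs Hs] : good a b.
  apply: cousin => //.
    move=> x y z xy yz [s1 c1 h1] [s2 c2 h2]; exists (s1 ++ s2).
      exact: interval_chain_cat c1 c2.
    rewrite big_cat/= (le_trans (ler_distD (f y) _ _))//.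
    lra.
  move=> t at_ tb; have [Ut|NUt] := pselect (U t).
    have /nbhs_ballP[r /= r0 rU] : nbhs t U by exact: open_nbhs_nbhs.
    exists r => // x y ax xt ty yb tx yt; exists [:: (x, y)].
      split=> // p; rewrite inE => /eqP -> /=; split=> //.
        exact: le_trans ty.
      move=> z /=; rewrite in_itv/= => /andP[xz zy]; apply: rU.
      rewrite /ball/= ltr_norml; apply/andP; split; lra.
    rewrite big_seq1/= -addrA lerDl addr_ge0 ?subr_ge0 ?ndPhi//.
      exact: le_trans ty.
    by rewrite mulr_ge0 ?(ltW e10)// subr_ge0 (le_trans xt).
  have [r r0 Hr] : exists2 d, 0 < d & forall x y, a <= x -> x <= t -> t <= y ->
      y <= b -> t - x < d -> y - t < d ->
       `|f y - f x| <= Phi y - Phi x + e1 * (y - x).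
    apply: contrapT => h; apply: NUt; apply: EU; apply: subE => /= h'; apply: h.
    exact: h'.
  exists r => // x y *; exists [::]; first by split.
  by rewrite big_nil add0r; exact: Hr.
have small : \sum_(p <- s) `|f p.2 - f p.1| < e / 2.
  rewrite (big_nth (0, 0)) big_mkord.
  apply: (Hd _ (fun i : 'I_(size s) => (nth (0, 0) s i).1)
               (fun i : 'I_(size s) => (nth (0, 0) s i).2)).
  - by move=> i; have [? ? ? _] := cs.2 _ (mem_nth (0, 0) (ltn_ord i)).
  - exact: interval_chain_trivIset cs.
  - by rewrite -lte_fin (le_lt_trans _ muU)//; exact: interval_chain_length cs.
have e1b : e1 * (b - a) <= e / 2.
  rewrite /e1 mulrAC ler_pdivrMr; last lra.
  have -> : e / 2 * (2 * (b - a + 1)) = e * (b - a) + e by field.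
  by rewrite lerDl ltW.
lra.
Qed.

End AbsolutelyContinuousGrowth.

(** * Primitives of norms of locally integrable operator functions *)

Section IntegrableNorm.
Context {R : realType}.
Local Notation mu := (@lebesgue_measure R).

Lemma lebesgue_ae_and (P Q : R -> Prop) :
  {ae mu, forall t, P t} -> {ae mu, forall t, Q t} ->
  {ae mu, forall t, P t /\ Q t}.
Proof.
move=> aP aQ; have F := ae_filter_ringOfSetsType mu.
by apply: filterS2 aP aQ.
Qed.

Lemma lebesgue_ae_imp (P Q : R -> Prop) : (forall t, P t -> Q t) ->
  {ae mu, forall t, P t} -> {ae mu, forall t, Q t}.
Proof.
move=> PQ aP; have F := ae_filter_ringOfSetsType mu.
by apply: filterS aP.
Qed.

(** The lower estimate [Phi'(t) >= g], in the straddling form that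
    [abs_cont_growth] consumes. *)
Definition straddle_bound (a b : R) (Phi : R -> R) (t g : R) : Prop :=
  forall e, 0 < e -> exists2 d, 0 < d &
    forall x y, a <= x -> x <= t -> t <= y -> y <= b ->
      t - x < d -> y - t < d -> g * (y - x) <= Phi y - Phi x + e * (y - x).

Lemma derivable_straddle (a b : R) (F : R -> R) (t : R) :
  derivable F t 1 -> straddle_bound a b F t (F^`()%classic t).
Proof.
move=> dF e e0; have := @derivableP _ _ _ _ _ _ dF.
rewrite -derive1E => -[_ DE].
have dF' : h^-1 *: ((F \o shift t) (h *: 1) - F t) @[h --> 0^'] --> F^`()%classic t.
  by rewrite derive1E; exact: dF.
move: dF' => /cvgrPdist_le/(_ e e0).
rewrite /= /dnbhs /within => /nbhs_ballP[d /= d0 Hd].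
have key h : `|h| < d -> `|F (t + h) - F t - h * F^`()%classic t| <= e * `|h|.
  move=> hd; have [->|h0] := eqVneq h 0.
    by rewrite addr0 subrr mul0r subr0 !normr0 mulr0.
  have := Hd h; rewrite /ball/= sub0r normrN => /(_ hd h0).
  rewrite /GRing.scale/= mulr1 (addrC h t) => H.
  have -> : F (t + h) - F t - h * F^`()%classic t =
            - (h * (F^`()%classic t - h^-1 * (F (t + h) - F t))).
    by field.
  by rewrite normrN normrM mulrC ler_wpM2r.
exists d => // x y ax xt ty yb tx yt.
have /ler_normlP[h1 h1'] := key (x - t) ltac:(rewrite distrC ger0_norm ?subr_ge0//).
have /ler_normlP[h2 h2'] := key (y - t) ltac:(rewrite ger0_norm ?subr_ge0//).
move: h1 h1' h2 h2'; rewrite distrC !(ger0_norm (x := _ - _)) ?subr_ge0//.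
rewrite !(addrC t) !subrK; lra.
Qed.

(** Setting [g] to zero on the null set where the limit fails gives a measurable
    function below [g] that equals [g] almost everywhere; the integral of this
    function is finite since the integral of a nonnegative function is monotone
    even without measurability of [g].  Its primitive is [Phi], and Lebesgue
    differentiation gives the bound. *)
Lemma ae_limit_primitive (g : R -> R) (gn : nat -> R -> R) (a b : R) : a <= b ->
  (forall t, 0 <= g t) -> (forall n, measurable_fun setT (gn n)) ->
  {ae mu, forall t, gn n t @[n --> \oo] --> g t} ->
  (\int[mu]_(t in `[a, b]) (g t)%:E < +oo)%E ->
  exists Phi : R -> R,
    [/\ forall x y, a <= x -> x <= y -> y <= b -> Phi x <= Phi y,
        {within `[a, b], continuous Phi}
      & {ae mu, forall t, a < t -> t < b -> straddle_bound a b Phi t (g t)}].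
Proof.
move=> ab g0 mgn [N [mN N0 subN]] intg.
pose h := g \_ (~` N).
have mh : measurable_fun setT h.
  apply: (measurable_fun_cvg (h := fun n => gn n \_ (~` N))).
    move=> n; apply/(measurable_restrictT _ (measurableC mN)).
    by apply: measurable_funTS; exact: mgn.
  move=> t _; rewrite /h /patch; case: ifPn => [|_]; last exact: cvg_cst.
  rewrite inE => Nt; apply: contrapT => H; apply: Nt; exact: subN.
pose k := h \_ `[a, b].
have mk : measurable_fun setT k.
  by apply/(measurable_restrictT _ (measurable_itv _)); exact: measurable_funTS.
have k0 t : 0 <= k t.
  by rewrite /k /patch; case: ifP => // _; rewrite /h /patch; case: ifP.
have kg t : k t <= (g \_ `[a, b]) t.
  by rewrite /k /patch; case: ifP => // _; rewrite /h /patch; case: ifP.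
have intk : (\int[mu]_t (k t)%:E < +oo)%E.
  apply: le_lt_trans intg; rewrite !ge0_integralE//; last 2 first.
    by move=> t _; rewrite lee_fin.
    by move=> t _; rewrite lee_fin.
  apply: ereal_sup_le => _ [f /= fk <-]; exists f => //= x.
  apply: (le_trans (fk x)); rewrite patchT ?inE//.
  by rewrite restrict_EFin lee_fin kg.
have ik D : measurable D -> mu.-integrable D (EFin \o k).
  move=> mD; apply: (@integrableS _ _ _ _ setT) => //.
  apply/integrableP; split; first exact/measurable_EFinP.
  by under eq_integral do rewrite /= ger0_norm//.
have lk : locally_integrable [set: R] k.
  split=> //; first exact: openT.
  move=> K _ cK; have /integrableP[_] := ik K (compact_measurable cK).
  by [].
exists (fun x => \int[mu]_(t in `[a, x]) (k t))%R; split.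
- move=> x y ax xy yb.
  rewrite -subr_ge0 Rintegral_itvB ?bnd_simp//; last exact: ik.
  by apply: Rintegral_ge0.
- apply: parameterized_integral_continuous => //; exact: ik.
- have H1 := FTC1 (a := BLeft a) (fun y => ik _ (measurable_itv _)) lk.
  have H2 : {ae mu, forall t, t \notin N}.
    by exists N; split=> // t /= /negP; rewrite negbK inE.
  apply: lebesgue_ae_imp (lebesgue_ae_and H1 H2) => t /= [Ft Nt] at_ tb.
  have [|dF F'] := Ft; first by rewrite lte_fin.
  have := derivable_straddle a b dF; rewrite F'.
  by rewrite /k patchT ?inE/= ?in_itv/= ?ltW// /h patchT// inE => /(@mem_set _ _ _); exact/negP.
Qed.

Lemma finite_range_measurable (T : Type) (f : R -> T) (phi : T -> R) :
  finite_set (range f) -> (forall y : T, measurable (f @^-1` [set y])) ->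
  measurable_fun setT (phi \o f).
Proof.
move=> finf mf _ Y mY; rewrite setTI.
have -> : (phi \o f) @^-1` Y =
    \bigcup_(y in range f `&` phi @^-1` Y) (f @^-1` [set y]).
  apply/seteqP; split => [x Yx|x [y [_ Yy] /= fxy]]; last first.
    by rewrite /preimage/= fxy.
  by exists (f x) => //; split => //; exists x.
apply: fin_bigcup_measurable => //; exact: finite_setIl.
Qed.

Lemma opnorm_distl (E F : hilbertType R) (S T : E -> F) :
  bounded_op S -> bounded_op T -> `|opnorm S - opnorm T| <= opnorm (S - T).
Proof.
move=> bS bT; have bST := bounded_opB bS bT.
have H (U V : E -> F) : bounded_op U -> bounded_op V ->
    (forall x, nrm (U x - V x) <= opnorm (S - T) * nrm x) ->
    opnorm U <= opnorm V + opnorm (S - T).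
  move=> bU bV UV; apply: opnorm_lub.
  - by rewrite (op_linear0 bU.1).
  - move=> x; rewrite mulrDl -(subrK (V x) (U x)) addrC.
    by rewrite (le_trans (nrmD _ _))// lerD ?opnorm_le// addrC UV.
  - by rewrite addr_ge0 ?opnorm_ge0.
apply/ler_normlP; split.
  rewrite opprB lerBlDl; apply: H => // x.
  by rewrite nrm_distC; exact: (opnorm_le bST).
by rewrite lerBlDl; apply: H => // x; exact: (opnorm_le bST).
Qed.

(** The norm of a strongly measurable operator function is an almost everywhere
    limit of the norms of its simple approximants, which have finite range and
    are therefore measurable. *)
Lemma op_L1loc_primitive (E F : hilbertType R) (f : R -> E -> F) (a b : R) :
  a <= b -> op_L1loc f ->
  exists Phi : R -> R,
    [/\ forall x y, a <= x -> x <= y -> y <= b -> Phi x <= Phi y,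
        {within `[a, b], continuous Phi}
      & {ae mu, forall t, a < t -> t < b ->
                  straddle_bound a b Phi t (opnorm (f t))}].
Proof.
move=> ab [bf [gn sgn gnf] intf].
apply: (ae_limit_primitive (gn := fun n t => opnorm (gn n t))) => //.
- by move=> t; exact: opnorm_ge0.
- move=> n; have [_ fin_ mg] := sgn n.
  exact: (finite_range_measurable (@opnorm R E F)).
- apply: lebesgue_ae_imp gnf => t gt; apply/cvgrPdist_le => e e0.
  move/cvgrPdist_le : gt => /(_ e e0); apply: filterS => n.
  rewrite sub0r normrN => /(le_trans (ler_norm _)); apply: le_trans.
  rewrite distrC; apply: opnorm_distl => //.
  by have [bg _ _] := sgn n.
Qed.

End IntegrableNorm.

(** * Uniqueness for the infinite system of output equations *)

Section HierarchyUniqueness.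
Context {R : realType} {E F : hilbertType R}.
Local Notation mu := (@lebesgue_measure R).

(** The norm of the weighted space of sequences that are [O(c^k)]. *)
Definition geometric_sup (c : R) (u : nat -> E) : R :=
  sup [set nrm (u k) / c ^+ k | k in [set: nat]].

Section GeometricSup.
Context {c : R} (c_gt0 : 0 < c).

Lemma geometric_sup_le (u : nat -> E) (M : R) :
  (forall k, nrm (u k) <= c ^+ k * M) -> geometric_sup c u <= M.
Proof.
move=> uM; apply: sup_le_ub; first by exists (nrm (u 0%N) / c ^+ 0), 0%N.
by move=> _ [k _ <-]; rewrite ler_pdivrMr ?exprn_gt0// mulrC.
Qed.

Lemma le_geometric_sup (u : nat -> E) (M : R) :
  (forall k, nrm (u k) <= c ^+ k * M) ->
  forall k, nrm (u k) <= c ^+ k * geometric_sup c u.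
Proof.
move=> uM k; rewrite mulrC -ler_pdivrMr ?exprn_gt0//.
apply: ub_le_sup; last by exists k.
by exists M => _ [j _ <-]; rewrite ler_pdivrMr ?exprn_gt0// mulrC.
Qed.

Lemma geometric_sup_ge0 (u : nat -> E) (M : R) :
  (forall k, nrm (u k) <= c ^+ k * M) -> 0 <= geometric_sup c u.
Proof.
move=> /le_geometric_sup/(_ 0%N); rewrite expr0 mul1r.
by apply: le_trans; exact: nrm_ge0.
Qed.

Lemma geometric_sup_dist (u v : nat -> E) (Mu Mv w : R) :
  (forall k, nrm (u k) <= c ^+ k * Mu) -> (forall k, nrm (v k) <= c ^+ k * Mv) ->
  (forall k, nrm (u k - v k) <= c ^+ k * w) ->
  `|geometric_sup c u - geometric_sup c v| <= w.
Proof.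
move=> uM vM uv.
have H (x y : nat -> E) M : (forall k, nrm (y k) <= c ^+ k * M) ->
    (forall k, nrm (x k - y k) <= c ^+ k * w) ->
    geometric_sup c x <= geometric_sup c y + w.
  move=> yM xy; apply: geometric_sup_le => k.
  rewrite -(subrK (y k) (x k)) mulrDr addrC (le_trans (nrmD _ _))//.
  by rewrite lerD ?xy//; exact: le_geometric_sup yM _.
apply/ler_normlP; split; rewrite ?opprB lerBlDl.
- by apply: H uM _ => k; rewrite nrm_distC.
- exact: H vM _.
Qed.

End GeometricSup.

(** A sequence of curves [h . k] solving
    [s1 h_k' = s2 h_(k+1) + g h_k] almost everywhere, with boundedness, absolute
    continuity and differentiability all uniform in [k] after division by [c^k].
    The modulus [w] plays the part of a common bound for the increments of the
    rescaled curves.  These conditions pass to differences of two solutions on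
    different state spaces, which is how they are used. *)
Record output_hierarchy (s1 s2 g : R -> E -> F) (c : R) (h : R -> nat -> E)
    : Prop := OutputHierarchy {
  hierarchy_bounded : forall t, exists M, forall k, nrm (h t k) <= c ^+ k * M ;
  hierarchy_abs_cont : exists2 w : R -> R -> R,
    (forall x y k, nrm (h y k - h x k) <= c ^+ k * w x y) &
    forall a b e : R, 0 < e -> exists2 d : R, 0 < d &
      forall (n : nat) (x y : 'I_n -> R),
        (forall i, a <= x i /\ x i <= y i /\ y i <= b) ->
        trivIset [set: 'I_n] (fun i => `]x i, y i[%classic) ->
        \sum_(i < n) (y i - x i) < d ->
        \sum_(i < n) w (x i) (y i) < e ;
  hierarchy_derive : {ae mu, forall t, exists2 G : nat -> E,
    forall k, s2 t (h t k.+1) - s1 t (G k) + g t (h t k) = 0 &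
    forall e, 0 < e -> exists2 d, 0 < d & forall z, `|z| < d -> forall k,
      nrm (h (t + z) k - h t k - z%:C%C *: G k) <= c ^+ k * (e * `|z|)}
}.

Lemma op_abs_cont_near (f : R -> E -> F) (t e : R) :
  op_abs_cont f -> 0 < e ->
  exists2 d, 0 < d & forall s, `|s - t| < d -> opnorm (f s - f t) < e.
Proof.
move=> acf e0; have [d d0 Hd] := acf (t - 1) (t + 1) e e0.
exists (Num.min d 1) => [|s]; first by rewrite lt_min d0 ltr01.
rewrite lt_min => /andP[sd]; rewrite ltr_norml => /andP[s1 s1'].
have [st|/ltW ts] := leP t s.
  have := Hd 1%N (fun=> t) (fun=> s).
  rewrite !big_ord1; apply; [by move=> _; split; lra|exact: trivIset_ord1|].
  by rewrite -[ltLHS]ger0_norm// subr_ge0.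
have := Hd 1%N (fun=> s) (fun=> t).
rewrite !big_ord1 opnorm_distC; apply; [by move=> _; split; lra|exact: trivIset_ord1|].
by rewrite -[ltLHS]ger0_norm ?subr_ge0// distrC.
Qed.

(** The inverse of [f t] bounds [f t] below, and a perturbation of half that size
    keeps half of the bound. *)
Lemma invertible_near_bounded_below (f : R -> E -> F) (t : R) :
  op_abs_cont f -> (forall s, invertible_op (f s)) ->
  exists2 K, 0 < K & exists2 d, 0 < d & forall s, `|s - t| < d ->
    forall v, nrm v <= K * nrm (f s v).
Proof.
move=> acf invf; have [bft [S [/bounded_opP[_ [m m0 Sm]] fK _]]] := invf t.
have K0 : 0 < 2 * (m + 1) by lra.
exists (2 * (m + 1)) => //.
have [||d d0 Hd] := @op_abs_cont_near f t (2 * (m + 1))^-1 => //.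
  by rewrite invr_gt0.
exists d => // s /Hd st v.
have bfs : bounded_op (f s) by have [] := invf s.
have dist : nrm (f t v - f s v) <= (2 * (m + 1))^-1 * nrm v.
  rewrite nrm_distC (le_trans (opnorm_le (bounded_opB bfs bft) v))//.
  by rewrite ler_wpM2r ?nrm_ge0// ltW.
have h1 : nrm v <= m * nrm (f t v) by rewrite -{1}(fK v) Sm.
have h2 : nrm (f t v) <= nrm (f t v - f s v) + nrm (f s v).
  by rewrite -{1}(subrK (f s v) (f t v)) nrmD.
have h3 : nrm v <= (m + 1) * (nrm (f s v) + (2 * (m + 1))^-1 * nrm v).
  rewrite (le_trans h1)//; apply: ler_pM => //; [exact: nrm_ge0|lra|lra].
have h4 : (m + 1) * ((2 * (m + 1))^-1 * nrm v) = nrm v / 2 by field; lra.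
rewrite mulrDr h4 in h3; lra.
Qed.

Context {s1 s2 g : R -> E -> F} {c : R} {h : R -> nat -> E}.
Context (s1_inv : forall t, invertible_op (s1 t)) (s1_ac : op_abs_cont s1).
Context (s2_L1 : op_L1loc s2) (g_L1 : op_L1loc g).
Context (c_gt0 : 0 < c) (hier : output_hierarchy s1 s2 g c h).

Let N t := geometric_sup c (h t).

Let N_ge0 t : 0 <= N t.
Proof. by have [M hM] := hierarchy_bounded hier t; exact: geometric_sup_ge0 hM. Qed.

Let N_ge t k : nrm (h t k) <= c ^+ k * N t.
Proof.
by have [M hM] := hierarchy_bounded hier t; exact: le_geometric_sup hM k.
Qed.

Let N_dist x y w : (forall k, nrm (h y k - h x k) <= c ^+ k * w) ->
  `|N y - N x| <= w.
Proof.
have [M hM] := hierarchy_bounded hier x.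
have [M' hM'] := hierarchy_bounded hier y.
exact: geometric_sup_dist hM' hM.
Qed.

Let N_ac a b : abs_cont_on a b N.
Proof.
have [w hw acw] := hierarchy_abs_cont hier => e e0.
have [d d0 Hd] := acw a b e e0; exists d => // n x y xy tI sd.
apply: le_lt_trans (Hd n x y xy tI sd); apply: ler_sum => i _.
exact: N_dist.
Qed.

Let N_cont : continuous N.
Proof. exact: abs_cont_on_continuous N_ac. Qed.

(** Integrated form of [|N'| <= K (c |s2| + |g|) N]: where the equations hold, the
    difference quotient of [h . k] is close to [G k], which the lower bound on
    [s1] estimates by [c^k K (c |s2| + |g|) M]. *)
Let hierarchy_growth a b K M (Phi2 Phig : R -> R) (p q : R) :
  0 <= K -> (forall t, a < t -> t < b -> forall v, nrm v <= K * nrm (s1 t v)) ->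
  (forall x y, a <= x -> x <= y -> y <= b -> Phi2 x <= Phi2 y) ->
  (forall x y, a <= x -> x <= y -> y <= b -> Phig x <= Phig y) ->
  {ae mu, forall t, a < t -> t < b -> straddle_bound a b Phi2 t (opnorm (s2 t))} ->
  {ae mu, forall t, a < t -> t < b -> straddle_bound a b Phig t (opnorm (g t))} ->
  a < p -> p <= q -> q < b -> (forall t, p <= t -> t <= q -> N t <= M) ->
  `|N q - N p| <= M * (K * (c * (Phi2 q - Phi2 p) + (Phig q - Phig p))).
Proof.
move=> K0 s1K nd2 ndg P2 Pg ap pq qb NM.
have M0 : 0 <= M by exact: le_trans (N_ge0 p) (NM _ (lexx p) pq).
pose Phi x := M * (K * (c * Phi2 x + Phig x)).
have -> : M * (K * (c * (Phi2 q - Phi2 p) + (Phig q - Phig p))) = Phi q - Phi p.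
  by rewrite /Phi; ring.
apply: abs_cont_growth => //.
  move=> x y px xy yq; rewrite ler_wpM2l// ler_wpM2l// lerD//.
    by rewrite ler_wpM2l ?(ltW c_gt0)//; apply: nd2 => //; lra.
  by apply: ndg => //; lra.
apply: lebesgue_ae_imp
  (lebesgue_ae_and (hierarchy_derive hier) (lebesgue_ae_and P2 Pg)).
move=> t [[G odeG derG] [H2 Hg]] pt tq e e0.
have at_ : a < t by lra. have tb : t < b by lra.
(* The two primitives enter with total weight [M K (c + 1)]; adding one keeps
   the denominator positive. *)
pose e2 := e / (2 * (M * K * (c + 1) + 1)).
have MK : 0 <= M * K * (c + 1) by rewrite !mulr_ge0// addr_ge0// ltW.
have e20 : 0 < e2 by rewrite divr_gt0//; lra.
have [d2 d20 {}H2] := H2 at_ tb e2 e20.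
have [dg dg0 {}Hg] := Hg at_ tb e2 e20.
have [d d0 Hd] := derG (e / 2) ltac:(lra).
exists (Num.min d (Num.min d2 dg)) => [|x y px xt ty yq].
  by rewrite !lt_min d0 d20.
rewrite !lt_min => /and3P[txd txd2 txdg] /and3P[ytd ytd2 ytdg].
have bs2 : bounded_op (s2 t) by have [] := s2_L1.
have bg : bounded_op (g t) by have [] := g_L1.
pose L := K * (opnorm (s2 t) * c + opnorm (g t)) * M.
have GL k : nrm (G k) <= c ^+ k * L.
  have /eqP := odeG k; rewrite addrAC subr_eq0 => /eqP odeGk.
  rewrite (le_trans (s1K t at_ tb (G k)))// -odeGk.
  have -> : c ^+ k * L = K *
      (opnorm (s2 t) * (c ^+ k.+1 * M) + opnorm (g t) * (c ^+ k * M)).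
    by rewrite /L exprS; ring.
  rewrite ler_wpM2l// (le_trans (nrmD _ _))// lerD//.
  - rewrite (le_trans (opnorm_le bs2 _))// ler_wpM2l ?opnorm_ge0//.
    by rewrite (le_trans (N_ge _ _))// ler_wpM2l ?exprn_ge0 ?(ltW c_gt0) ?NM.
  - rewrite (le_trans (opnorm_le bg _))// ler_wpM2l ?opnorm_ge0//.
    by rewrite (le_trans (N_ge _ _))// ler_wpM2l ?exprn_ge0 ?(ltW c_gt0) ?NM.
have key : `|N y - N x| <= (y - x) * L + e / 2 * (y - x).
  apply: N_dist => k.
  have hy := Hd (y - t) ltac:(rewrite ger0_norm ?subr_ge0//) k.
  have hx := Hd (x - t) ltac:(rewrite distrC ger0_norm ?subr_ge0//) k.
  rewrite !(addrC t) !subrK in hy hx.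
  rewrite distrC !ger0_norm ?subr_ge0// in hx hy.
  have -> : h y k - h x k = (y - x)%:C%C *: G k +
      ((h y k - h t k - (y - t)%:C%C *: G k) -
       (h x k - h t k - (x - t)%:C%C *: G k)).
    have -> : (y - x)%:C%C = (y - t)%:C%C - (x - t)%:C%C :> R[i].
      by rewrite -raddfB/=; congr (_%:C)%C; ring.
    rewrite scalerBl; set u := _ *: G k; set v := _ *: G k.
    rewrite opprD [X in _ = _ + X]addrACA -opprD [RHS]addrC subrK.
    by rewrite opprB addrA subrK.
  rewrite (le_trans (nrmD _ _))//.
  rewrite mulrDr lerD//.
    rewrite nrmZ nrmC ger0_norm ?subr_ge0 ?(le_trans xt ty)//.
    by rewrite mulrCA ler_wpM2l// subr_ge0 (le_trans xt ty).
  rewrite (le_trans (nrmB _ _))// (le_trans (lerD hy hx))// -mulrDr -mulrDr.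
  by rewrite addrA subrK.
have {}H2 := H2 x y ltac:(lra) xt ty ltac:(lra) txd2 ytd2.
have {}Hg := Hg x y ltac:(lra) xt ty ltac:(lra) txdg ytdg.
have yx : 0 <= y - x by lra.
have KM : 0 <= K * M by rewrite mulr_ge0.
have h1 := ler_wpM2l (ltW c_gt0) H2.
have h2 := ler_wpM2l KM (lerD h1 Hg).
have h3 : M * K * (c + 1) * e2 <= e / 2.
  have -> : e2 = (e / 2) / (M * K * (c + 1) + 1).
    by rewrite /e2 invfM mulrA.
  rewrite mulrA ler_pdivrMr; last lra.
  by rewrite [leRHS]mulrDr mulr1 [leLHS]mulrC lerDl; lra.
have h4 := ler_wpM2r yx h3.
rewrite (le_trans key)// /Phi /L.
move: h2 h4; set X := opnorm _; set Y := opnorm _; lra.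
Qed.

(** On an interval around [t] where the primitives vary so little that the
    growth factor is at most 1/4, the maximum of [N] is at most a quarter of
    itself. *)
Let hierarchy_local_zero t : N t = 0 ->
  exists2 d, 0 < d & forall s, `|s - t| <= d -> N s = 0.
Proof.
move=> Nt; have [K K0 [d0 d00 s1K]] := invertible_near_bounded_below t s1_ac s1_inv.
pose a := t - d0 / 2; pose b := t + d0 / 2.
have ab : a <= b by rewrite /a /b; lra.
have [Phi2 [nd2 c2 P2]] := op_L1loc_primitive ab s2_L1.
have [Phig [ndg cg Pg]] := op_L1loc_primitive ab g_L1.
have ta : a < t by rewrite /a; lra. have tb : t < b by rewrite /b; lra.
have near_t (Phi : R -> R) e : 0 < e -> {within `[a, b], continuous Phi} ->
    exists2 d, 0 < d & forall s, `|s - t| < d -> `|Phi s - Phi t| <= e.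
  move=> e0 /(continuous_within_itvP _ (lt_trans ta tb))[/(_ t)].
  rewrite in_itv/= ta tb => /(_ isT) /cvgrPdist_le/(_ e e0)/nbhs_ballP.
  move=> [d /= dgt0 Hd] _ _; exists d => // s st.
  by rewrite distrC; apply: Hd; rewrite /ball/= distrC.
have cK0 : 0 < 8 * (K * (c + 1)) by rewrite !mulr_gt0// ltr_wpDr.
(* Each primitive varies by at most [2 e], and [K (c + 1) 2 e = 1/4]. *)
pose e := (8 * (K * (c + 1)))^-1.
have e0 : 0 < e by rewrite invr_gt0.
have [d2 d20 H2] := near_t _ e e0 c2.
have [dg dg0 Hg] := near_t _ e e0 cg.
(* Halving keeps the closed interval of radius [d] inside the open one. *)
pose d := Num.min (d0 / 2) (Num.min d2 dg) / 2.
have dm : 0 < Num.min (d0 / 2) (Num.min d2 dg).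
  by rewrite !lt_min d20 dg0 divr_gt0.
have dgt0 : 0 < d by rewrite divr_gt0.
have dlt s : `|s - t| <= d -> [/\ `|s - t| < d0 / 2, `|s - t| < d2 & `|s - t| < dg].
  move=> sd; have : `|s - t| < Num.min (d0 / 2) (Num.min d2 dg).
    by rewrite (le_lt_trans sd)// /d; lra.
  by rewrite !lt_min => /and3P[].
exists d => // s sd.
have [m mI Nm] := @EVT_max _ N (t - d) (t + d) ltac:(lra)
  (continuous_subspaceT N_cont).
rewrite in_itv/= in mI.
have NM u : `|u - t| <= d -> N u <= N m.
  rewrite ler_norml => /andP[u1 u2]; apply: Nm; rewrite in_itv/=; lra.
have md : `|m - t| <= d by move: mI => /andP[u1 u2]; rewrite ler_norml; lra.
have small (Phi : R -> R) x y : x <= y -> `|x - t| <= d -> `|y - t| <= d ->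
    (forall u, `|u - t| <= d -> `|Phi u - Phi t| <= e) ->
    Phi y - Phi x <= 2 * e.
  move=> xy xd yd HP; have /ler_normlP[_ h1] := HP _ yd.
  by have /ler_normlP[h2 _] := HP _ xd; lra.
have growth p q : p <= q -> `|p - t| <= d -> `|q - t| <= d ->
    `|N q - N p| <= N m / 4.
  move=> pq pd qd; have [pd1 _ _] := dlt _ pd; have [qd1 _ _] := dlt _ qd.
  have ap : a < p by move: pd1; rewrite ltr_norml /a => /andP[]; lra.
  have qb : q < b by move: qd1; rewrite ltr_norml /b => /andP[]; lra.
  have s1K' u : a < u -> u < b -> forall v, nrm v <= K * nrm (s1 u v).
    move=> au ub; apply: s1K; rewrite ltr_norml; move: au ub; rewrite /a /b.
    by lra.
  have NM' u : p <= u -> u <= q -> N u <= N m.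
    move=> pu uq; apply: NM; move: pd qd; rewrite !ler_norml; lra.
  apply: le_trans (hierarchy_growth (ltW K0) s1K' nd2 ndg P2 Pg ap pq qb NM') _.
  rewrite ler_wpM2l//.
  have h2 : Phi2 q - Phi2 p <= 2 * e.
    by apply: small => // u ud; apply: H2; case: (dlt _ ud).
  have hg : Phig q - Phig p <= 2 * e.
    by apply: small => // u ud; apply: Hg; case: (dlt _ ud).
  have -> : 4^-1 = K * (c * (2 * e) + 2 * e) :> R.
    by rewrite /e; field; rewrite !gt_eqF//= ltr_wpDr.
  by rewrite ler_wpM2l ?(ltW K0)// lerD// ler_wpM2l// ltW.
have tt : `|t - t| <= d by rewrite subrr normr0 ltW.
have Nm0 : N m <= N m / 4.
  have [tm|/ltW mt] := leP t m.
    by have := growth _ _ tm tt md; rewrite Nt subr0 ger0_norm.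
  by have := growth _ _ mt md tt; rewrite Nt sub0r normrN ger0_norm.
apply/eqP; rewrite eq_le N_ge0 andbT (le_trans (NM _ sd))//.
by have := N_ge0 m; lra.
Qed.

(** The zero set of [N] is closed by continuity and open by the local statement,
    so it is the whole line. *)
Lemma output_hierarchy_unique (r : R) :
  (forall k, h r k = 0) -> forall s k, h s k = 0.
Proof.
move=> hr s k; apply: nrm_eq0; apply/eqP; rewrite eq_le nrm_ge0 andbT.
suff -> : 0 = c ^+ k * N s by exact: N_ge.
have Nr : N r = 0.
  apply/eqP; rewrite eq_le N_ge0 andbT; apply: geometric_sup_le => // j.
  by rewrite hr nrm0 mulr0.
pose Z := [set u | N u = 0].
have oZ : open Z.
  rewrite openE => u Zu; have [d d0 Hd] := hierarchy_local_zero Zu.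
  apply/nbhs_ballP; exists d => // v; rewrite /ball/= distrC => /ltW.
  exact: Hd.
have cZ : closed Z.
  rewrite (_ : Z = N @^-1` [set 0])//.
  by apply: preimage_closed => // u; exact: N_cont.
suff ZT : Z = [set: R].
  have Zs : Z s by rewrite ZT.
  by rewrite (Zs : N s = 0) mulr0.
have /connected_intervalP : is_interval [set: R] by [].
apply.
- by exists r.
- by exists Z => //; rewrite setTI.
- by exists Z => //; rewrite setTI.
Qed.

End HierarchyUniqueness.

(** * Output functions of a vessel *)

Section OutputHierarchyOfVessel.
Context {R : realType} {X : external_data R}.
Implicit Types V W : vessel R X.
Local Notation mu := (@lebesgue_measure R).

Lemma lebesgue_ae_exists (P : R -> Prop) :
  {ae mu, forall t, P t} -> exists t, P t.
Proof.
move=> [N [mN N0 PN]]; apply: contrapT => NP.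
have : (mu `[0%R, 1%R]%classic <= mu N)%E.
  by apply: le_measure; rewrite ?inE// => t _; apply: PN => Pt; apply: NP; exists t.
rewrite lebesgue_measure_itv/= lte_fin ltr01 oppr0 adde0.
by rewrite -[X in (_ <= X)%E]/(lebesgue_measure N) (N0 : lebesgue_measure N = 0%E)
  lee_fin ler10.
Qed.

Lemma vF_bounded V t s : bounded_op (vF V t s).
Proof. by have [] := vF_invertible _ _ V t s. Qed.

Lemma bounded_op_CF V t s : bounded_op (fun x => vC V t (vF V t s x)).
Proof. exact: (bounded_op_comp (vC_bounded _ _ V t) (vF_bounded V t s)). Qed.

(** Absolute continuity for a single reference time [t] transfers to every [r]
    because [F(s,r) = F(s,t) F(t,r)]. *)
Lemma op_abs_cont_CF V r : op_abs_cont (fun s x => vC V s (vF V s r x)).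
Proof.
have [t act] := lebesgue_ae_exists (vCF_abs_cont _ _ V).
move=> a b e e0; have F0 := opnorm_ge0 (vF_bounded V t r).
have e1 : 0 < e / (opnorm (vF V t r) + 1) by rewrite divr_gt0// ltr_wpDl.
have [d d0 Hd] := act a b _ e1; exists d => // n x y xy tI sd.
have {Hd} := Hd n x y xy tI sd; rewrite ltr_pdivlMr ?ltr_wpDl// => Hd.
apply: le_lt_trans Hd; rewrite mulrDr mulr1 ler_wpDr//.
  by rewrite sumr_ge0// => i _; apply: opnorm_ge0; apply: bounded_opB;
    exact: bounded_op_CF.
rewrite mulr_suml; apply: ler_sum => i _.
rewrite [X in opnorm X](_ : _ = (fun z => vC V (y i) (vF V (y i) t z) -
    vC V (x i) (vF V (x i) t z)) \o vF V t r); last first.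
  by apply: funext => z; rewrite /= !vF_comp.
apply: opnorm_comp_le; last exact: vF_bounded.
by apply: (bounded_opB (bounded_op_CF V _ t) (bounded_op_CF V _ t)).
Qed.

Lemma vA_iter V t n s x :
  iter n (vA V t) (vF V t s x) = vF V t s (iter n (vA V s) x).
Proof. by elim: n => //= n ->; rewrite vessel_Lax. Qed.

(** The output condition of the vessel, applied to [A(r)^k x]: since [A] commutes
    with [F], its first term is the output function of index [k+1]. *)
Lemma vessel_output_hierarchy V r x c :
  0 < c -> (forall y, nrm (vA V r y) <= c * nrm y) ->
  output_hierarchy (sigma1s X) (sigma2s X) (gammas X) c
    (fun s k => vC V s (vF V s r (iter k (vA V r) x))).
Proof.
move=> c0 Ac; have iterc k := nrm_iter_le x k (ltW c0) Ac.
have x0 := nrm_ge0 x; have c0' k : 0 <= c ^+ k by rewrite exprn_ge0// ltW.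
split.
- move=> t; exists (opnorm (fun x => vC V t (vF V t r x)) * nrm x) => k.
  rewrite (le_trans (opnorm_le (bounded_op_CF V t r) _))// mulrCA.
  by rewrite ler_wpM2l// (opnorm_ge0 (bounded_op_CF V t r)).
- exists (fun s t => opnorm ((fun x => vC V t (vF V t r x)) -
                             (fun x => vC V s (vF V s r x))) * nrm x).
    move=> s t k; have bYB := bounded_opB (bounded_op_CF V t r) (bounded_op_CF V s r).
    rewrite mulrCA (le_trans (opnorm_le bYB _))//.
    by rewrite ler_wpM2l// opnorm_ge0.
  move=> a b e e0.
  have e1 : 0 < e / (nrm x + 1) by rewrite divr_gt0// ltr_wpDl.
  have [d d0 Hd] := @op_abs_cont_CF V r a b _ e1.
  exists d => // n p q pq tI sd.
  have {Hd} := Hd n p q pq tI sd; rewrite ltr_pdivlMr ?ltr_wpDl// => Hd.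
  apply: le_lt_trans Hd; rewrite mulrDr mulr1 ler_wpDr//.
    by rewrite sumr_ge0// => i _; apply: opnorm_ge0; apply: bounded_opB;
      exact: bounded_op_CF.
  by rewrite mulr_suml.
- apply: lebesgue_ae_imp (vessel_output _ _ V r) => t [G [bG DG] ode].
  exists (fun k => G (iter k (vA V r) x)) => [k|e e0].
    by have := ode (iter k (vA V r) x); rewrite -vessel_Lax.
  have e1 : 0 < e / (nrm x + 1) by rewrite divr_gt0// ltr_wpDl.
  move/cvgrPdist_le : DG => /(_ _ e1).
  rewrite /= /dnbhs /within => /nbhs_ballP[d /= d0 Hd].
  exists d => // z zd k.
  have [->|z0] := eqVneq z 0.
    by rewrite addr0 subrr scale0r subrr nrm0 normr0 !mulr0.
  have := Hd z; rewrite /ball/= sub0r normrN => /(_ zd z0).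
  set D := (_ *: _ - G); move=> HD.
  have bD : bounded_op D.
    apply: bounded_opB => //; apply: bounded_opZ.
    by apply: bounded_opB; exact: bounded_op_CF.
  have {}HD : opnorm D <= e / (nrm x + 1).
    by move: HD; rewrite sub0r normrN; apply: le_trans; exact: ler_norm.
  set u := iter k _ _.
  have z0' : z%:C%C != 0 :> R[i] by rewrite fmorph_eq0.
  have -> : vC V (t + z) (vF V (t + z) r u) - vC V t (vF V t r u) -
            z%:C%C *: G u = z%:C%C *: D u.
    rewrite /D !fctE scalerBr; congr (_ - _).
    by rewrite scalerA mulfV// scale1r.
  rewrite nrmZ nrmC mulrA (mulrC _ `|z|) ler_wpM2l//.
  rewrite (le_trans (opnorm_le bD _))//.
  rewrite (le_trans (ler_pM _ _ HD (iterc k)))// ?opnorm_ge0// ?nrm_ge0//.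
  rewrite mulrCA ler_wpM2l//.
  by rewrite mulrAC ler_pdivrMr ?ltr_wpDl// mulrDr mulr1 lerDl ltW.
Qed.

Lemma subrACA (Z : zmodType) (a b c d : Z) :
  (a - b) - (c - d) = (a - c) - (b - d).
Proof. by rewrite !opprD addrACA. Qed.

Lemma output_hierarchyB {E F : hilbertType R} (s1 s2 g : R -> E -> F) (c : R)
    (h h' : R -> nat -> E) :
  (forall t, linear (s1 t)) -> (forall t, linear (s2 t)) ->
  (forall t, linear (g t)) ->
  output_hierarchy s1 s2 g c h -> output_hierarchy s1 s2 g c h' ->
  output_hierarchy s1 s2 g c (fun t k => h t k - h' t k).
Proof.
move=> l1 l2 lg [bh [w hw acw] dh] [bh' [w' hw' acw'] dh']; split.
- move=> t; have [M hM] := bh t; have [M' hM'] := bh' t; exists (M + M') => k.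
  by rewrite mulrDr (le_trans (nrmB _ _))// lerD.
- exists (fun x y => w x y + w' x y).
    move=> x y k; rewrite mulrDr subrACA.
    by rewrite (le_trans (nrmB _ _))// lerD.
  move=> a b e e0.
  have e2 : 0 < e / 2 by rewrite divr_gt0.
  have [d d0 Hd] := acw a b _ e2; have [d' d0' Hd'] := acw' a b _ e2.
  exists (Num.min d d') => [|n x y xy tI]; first by rewrite lt_min d0.
  rewrite lt_min => /andP[/(Hd n x y xy tI) ? /(Hd' n x y xy tI) ?].
  by rewrite big_split/=; lra.
- apply: lebesgue_ae_imp (lebesgue_ae_and dh dh').
  move=> t [[G o d] [G' o' d']]; exists (fun k => G k - G' k) => [k|e e0].
    rewrite (op_linearB (l1 t)) (op_linearB (l2 t)) (op_linearB (lg t)).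
    by rewrite subrACA addrACA -opprD o o' subrr.
  have e2 : 0 < e / 2 by rewrite divr_gt0.
  have [r r0 Hr] := d _ e2; have [r' r0' Hr'] := d' _ e2.
  exists (Num.min r r') => [|z]; first by rewrite lt_min r0.
  rewrite lt_min => /andP[/Hr{}Hr /Hr'{}Hr'] k.
  rewrite scalerBr (subrACA (h (t + z) k)) (subrACA (_ - _) (_ - _)).
  rewrite (le_trans (nrmB _ _))// (le_trans (lerD (Hr k) (Hr' k)))//.
  by rewrite -mulrDr -mulrDl -splitr.
Qed.

(** The differences of the output functions of the two vessels satisfy the
    same system, whose coefficients are external data; they vanish at [s = r]
    by hypothesis, hence everywhere. *)
Lemma two_point_moments V W r (x : vH V r) (z : vH W r) :
  (forall k, vC V r (iter k (vA V r) x) = vC W r (iter k (vA W r) z)) ->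
  forall s k, vC V s (vF V s r (iter k (vA V r) x)) =
              vC W s (vF W s r (iter k (vA W r) z)).
Proof.
move=> xz s k.
have [_ [c c0 Ac]] := (bounded_opP _).1 (vA_bounded _ _ V r).
have [_ [c' c0' Ac']] := (bounded_opP _).1 (vA_bounded _ _ W r).
have hV := @vessel_output_hierarchy V r x (c + c' + 1) ltac:(lra) _.
have hW := @vessel_output_hierarchy W r z (c + c' + 1) ltac:(lra) _.
have Ac1 y : nrm (vA V r y) <= (c + c' + 1) * nrm y.
  by rewrite (le_trans (Ac _))// ler_wpM2r ?nrm_ge0//; lra.
have Ac1' y : nrm (vA W r y) <= (c + c' + 1) * nrm y.
  by rewrite (le_trans (Ac' _))// ler_wpM2r ?nrm_ge0//; lra.
have l1 t : linear (sigma1s X t) by have [[]] := sigma1s_invertible _ X t.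
have l2 t : linear (sigma2s X t) by have [/(_ t)[]] := sigma2s_L1loc _ X.
have lg t : linear (gammas X t) by have [/(_ t)[]] := gammas_L1loc _ X.
have c1 : 0 < c + c' + 1 by lra.
have hD := output_hierarchyB l1 l2 lg (hV Ac1) (hW Ac1').
have := output_hierarchy_unique (sigma1s_invertible _ X) (sigma1s_abs_cont _ X)
  (sigma2s_L1loc _ X) (gammas_L1loc _ X) c1 hD (r := r) _ s k.
move=> H; apply/eqP; rewrite -subr_eq0; apply/eqP; apply: H => j.
by rewrite !vF_id xz subrr.
Qed.

End OutputHierarchyOfVessel.

(** * Resolvents and moments *)

Section Resolvents.
Context {R : realType}.
Implicit Types H E : hilbertType R.

Lemma iter_linear H (A : H -> H) n : linear A -> linear (iter n A).
Proof. by move=> lA a x y; elim: n => //= n ->; rewrite lA. Qed.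

Lemma invertible_of_bounded_below H E (T : H -> E) (m : R) :
  bounded_op T -> 0 < m -> (forall x, m * nrm x <= nrm (T x)) ->
  (forall y, exists x, T x = y) -> invertible_op T.
Proof.
move=> bT m0 Tm /choice[S TS]; have [lT _] := bT; split=> //.
have injT : injective T.
  move=> x y Txy; apply/eqP; rewrite -subr_eq0; apply/eqP; apply: nrm_eq0.
  have := Tm (x - y); rewrite (op_linearB lT) Txy subrr nrm0 => h.
  by apply/eqP; rewrite eq_le nrm_ge0 andbT -(pmulr_rle0 _ m0).
have ST : cancel T S by move=> x; apply: injT; rewrite TS.
exists S; split=> //; apply/bounded_opP; split.
  by move=> a x y; apply: injT; rewrite lT !TS.
exists m^-1 => [|x]; first by rewrite invr_ge0 ltW.
by rewrite ler_pdivlMl// (le_trans (Tm _))// TS.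
Qed.

Lemma complete_geometric H (u : nat -> H) (K q : R) : 0 <= q -> q < 1 ->
  (forall n, nrm (u n.+1 - u n) <= K * q ^+ n) ->
  exists x, forall e, 0 < e -> \forall n \near \oo, nrm (x - u n) < e.
Proof.
move=> q0 q1 uK; have K0 : 0 <= K.
  by have := uK 0%N; rewrite mulr1; apply: le_trans; exact: nrm_ge0.
(* Telescoping form, chosen so that the induction on [m] closes. *)
have tail n m : nrm (u (n + m)%N - u n) <= K / (1 - q) * (q ^+ n - q ^+ (n + m)).
  elim: m => [|m IH]; first by rewrite addn0 !subrr nrm0 mulr0.
  rewrite addnS -(subrKA (u (n + m)%N)) (le_trans (nrmD _ _))//.
  rewrite (le_trans (lerD (uK _) IH))// exprS.
  rewrite [leLHS](_ : _ = K / (1 - q) * (q ^+ n - q * q ^+ (n + m)))//.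
  by field; rewrite subr_eq0 gt_eqF.
have tail' n m : nrm (u (n + m)%N - u n) <= K / (1 - q) * q ^+ n.
  apply: (le_trans (tail n m)).
  rewrite ler_wpM2l ?divr_ge0 ?subr_ge0 ?(ltW q1)//.
  by rewrite gerDl oppr_le0 exprn_ge0.
have small e : 0 < e -> exists n, K / (1 - q) * q ^+ n < e.
  move=> e0.
  have : (fun n => K / (1 - q) * q ^+ n) @ \oo --> K / (1 - q) * 0.
    apply: cvgMr; apply: cvg_expr; by rewrite ger0_norm.
  rewrite mulr0 => /cvgrPdist_lt/(_ e e0)[n _ /(_ n (leqnn n))].
  rewrite sub0r normrN ger0_norm; first by exists n.
  by rewrite mulr_ge0 ?divr_ge0 ?subr_ge0 ?(ltW q1) ?exprn_ge0.
have : cvg (u @ \oo).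
  apply/cauchy_cvgP; apply: cauchy_exP => e e0.
  have eE : e = (complex.Re e)%:C%C.
    by move: e0; rewrite ltcE /= => /andP[/eqP]; case: (e) => a b /= ->.
  have [n Hn] : exists n, K / (1 - q) * q ^+ n < complex.Re e.
    by apply: small; move: e0; rewrite eE (ltcR 0).
  exists (u n); exists n => // m /= nm; rewrite -(subnKC nm).
  rewrite -ball_normE /ball_/= nrmE eE ltcR nrm_distC.
  exact: le_lt_trans (tail' _ _) Hn.
move=> /cvg_ex[x ux]; exists x => e e0.
have e0' : 0 < e%:C%C :> R[i] by rewrite (ltcR 0).
move/cvgrPdist_lt : ux => /(_ _ e0'); apply: filterS => n.
by rewrite nrmE ltcR.
Qed.

Lemma bounded_op_resolvent_pencil H (A : H -> H) (l : R[i]) :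
  bounded_op A -> bounded_op (fun x => l *: x - A x).
Proof.
move=> bA; apply: (@bounded_opB _ _ _ (fun x => l *: x)) => //.
apply/bounded_opP; split=> [a x y|]; first by rewrite scalerDr !scalerA mulrC.
by exists (nrm l) => [|x]; rewrite ?nrm_ge0// nrmZ.
Qed.

Lemma resolvent_pencil_bounded_below H (A : H -> H) (c : R) (l : R[i]) :
  (forall y, nrm (A y) <= c * nrm y) ->
  forall x, (nrm l - c) * nrm x <= nrm (l *: x - A x).
Proof.
move=> Ac x; rewrite mulrBl lerBlDr -nrmZ -{1}(subrK (A x) (l *: x)).
by rewrite (le_trans (nrmD _ _))// lerD2l.
Qed.

(** [x -> l^-1 (y + A x)] is a contraction, so [l x - A x = y] has a solution for
    every [y]. *)
Lemma resolvent_set_large H (A : H -> H) (c : R) (l : R[i]) :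
  bounded_op A -> 0 <= c -> (forall y, nrm (A y) <= c * nrm y) -> c < nrm l ->
  resolvent_set A l.
Proof.
move=> bA c0 Ac cl; have [lA _] := bA; have l0 : 0 < nrm l by exact: le_lt_trans cl.
have ln0 : l != 0 by apply: contraTneq l0 => ->; rewrite nrm0 ltxx.
apply: (@invertible_of_bounded_below _ _ _ (nrm l - c)).
- exact: bounded_op_resolvent_pencil.
- by rewrite subr_gt0.
- exact: resolvent_pencil_bounded_below.
move=> y; pose f x := l^-1 *: (y + A x); pose u n := iter n f 0.
pose q := c / nrm l.
have q0 : 0 <= q by rewrite divr_ge0 ?nrm_ge0.
have fq a b : nrm (f a - f b) <= q * nrm (a - b).
  rewrite /f -scalerBr nrmZ nrmV addrAC opprD addrA subrr sub0r addrC.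
  by rewrite -(op_linearB lA) /q (mulrC c) -mulrA ler_wpM2l ?invr_ge0 ?nrm_ge0.
have [||x ux] := @complete_geometric H u (nrm (u 1%N - u 0%N)) q q0.
- by rewrite /q ltr_pdivrMr// mul1r.
- elim=> [|n IH]; first by rewrite mulr1.
  by rewrite exprS mulrCA (le_trans (fq _ _))// ler_wpM2l.
exists x; have fx : x = f x.
  apply/eqP; rewrite -subr_eq0; apply/eqP; apply: nrm_eq0; apply/eqP.
  rewrite eq_le nrm_ge0 andbT; apply/ler_addgt0Pr => e e0; rewrite add0r.
  have e1 : 0 < e / (1 + q) by rewrite divr_gt0// ltr_wpDr.
  have [n _ Hn] := ux _ e1.
  have h1 := Hn n.+1 (leqnSn n); have h2 := Hn n (leqnn n).
  have h3 : nrm (u n.+1 - f x) <= q * nrm (x - u n).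
    by rewrite (le_trans (fq _ _))// nrm_distC.
  rewrite -(subrKA (u n.+1)) (le_trans (nrmD _ _))//.
  rewrite (le_trans (lerD (ltW h1) (le_trans h3 (ler_wpM2l q0 (ltW h2)))))//.
  by rewrite -{1}[e / _]mul1r -mulrDl mulrC divfK// gt_eqF// ltr_wpDr.
have -> : l *: x = y + A x by rewrite {1}fx scalerA mulfV// scale1r.
by rewrite addrK.
Qed.

Lemma resolventP H (A : H -> H) (l : R[i]) : resolvent_set A l ->
  is_inverse_op (fun x => l *: x - A x) (resolvent A l).
Proof. by move=> [_ exS]; exact: xgetPex. Qed.

Lemma resolvent_eq H (A : H -> H) (l : R[i]) : resolvent_set A l ->
  forall x, l *: resolvent A l x = x + A (resolvent A l x).
Proof. by move=> /resolventP[_ _ /(_ _) h] x; rewrite -{2}(h x) subrK. Qed.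

Lemma resolvent_uniq H (A : H -> H) (l : R[i]) : resolvent_set A l ->
  forall x y, l *: y - A y = x -> resolvent A l x = y.
Proof. by move=> /resolventP[_ h _] x y <-; rewrite h. Qed.

Lemma resolvent_decay H (A : H -> H) (c : R) (l : R[i]) :
  (forall y, nrm (A y) <= c * nrm y) -> resolvent_set A l ->
  forall x, (nrm l - c) * nrm (resolvent A l x) <= nrm x.
Proof.
move=> Ac rl x; rewrite (le_trans (resolvent_pencil_bounded_below _ Ac _))//.
by have [_ _ h] := resolventP rl; rewrite h.
Qed.

(** The resolvent equation [l R = 1 + A R], multiplied by [C A^n] from the left:
    it expresses the moment of order [n] through resolvents. *)
Lemma resolvent_moment_step H E (A : H -> H) (C : H -> E) (l : R[i]) n x :
  bounded_op A -> bounded_op C -> resolvent_set A l ->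
  l *: C (iter n A (resolvent A l x)) =
  C (iter n A x) + C (iter n.+1 A (resolvent A l x)).
Proof.
move=> [lA _] [lC _] rl.
rewrite -(op_linearZ lC) -(op_linearZ (iter_linear n lA)) resolvent_eq//.
by rewrite (op_linearD (iter_linear n lA)) (op_linearD lC) -iterSr.
Qed.

Section TwoRealizations.
Context {H K E : hilbertType R} {A : H -> H} {A' : K -> K} {C : H -> E}
  {C' : K -> E}.
Context (bA : bounded_op A) (bA' : bounded_op A').
Context (bC : bounded_op C) (bC' : bounded_op C').

(** The difference [delta n] of the two [C A^n R x] gets multiplied by [l] when [n]
    increases, but it is bounded by a multiple of [c^n] with [c < |l|]; so it is
    zero. *)
Lemma resolvents_of_moments (c : R) (l : R[i]) x x' :
  0 <= c -> (forall y, nrm (A y) <= c * nrm y) ->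
  (forall y, nrm (A' y) <= c * nrm y) -> c < nrm l ->
  resolvent_set A l -> resolvent_set A' l ->
  (forall n, C (iter n A x) = C' (iter n A' x')) ->
  C (resolvent A l x) = C' (resolvent A' l x').
Proof.
move=> c0 Ac Ac' cl rl rl' xx'; have l0 : 0 < nrm l by exact: le_lt_trans cl.
pose y := resolvent A l x; pose y' := resolvent A' l x'.
pose delta n := C (iter n A y) - C' (iter n A' y').
have step n : delta n.+1 = l *: delta n.
  rewrite /delta scalerBr !resolvent_moment_step// xx' opprD addrACA subrr.
  by rewrite add0r.
pose M := opnorm C * nrm y + opnorm C' * nrm y'.
have deltaM n : nrm (delta n) <= M * c ^+ n.
  rewrite /delta (le_trans (nrmB _ _))// mulrDl lerD// -mulrA.
  - rewrite (le_trans (opnorm_le bC _))// ler_wpM2l ?opnorm_ge0// mulrC.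
    exact: nrm_iter_le.
  - rewrite (le_trans (opnorm_le bC' _))// ler_wpM2l ?opnorm_ge0// mulrC.
    exact: nrm_iter_le.
have deltaE n : nrm (delta n) = nrm l ^+ n * nrm (delta 0%N).
  by elim: n => [|n IH]; rewrite ?mul1r// step nrmZ IH exprS mulrA.
apply/eqP; rewrite -subr_eq0; apply/eqP; apply: nrm_eq0; apply/eqP.
rewrite eq_le nrm_ge0 andbT -[X in nrm X]/(delta 0%N).
have cvgM : (fun n => M * (c / nrm l) ^+ n) @ \oo --> M * 0.
  apply: cvgMr; apply: cvg_expr.
  by rewrite ger0_norm ?divr_ge0 ?nrm_ge0// ltr_pdivrMr// mul1r.
rewrite mulr0 in cvgM; rewrite -(cvg_lim _ cvgM)//.
apply: limr_ge; first by apply/cvg_ex; exists 0.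
apply: nearW => n; rewrite expr_div_n mulrA ler_pdivlMr ?exprn_gt0//.
by rewrite mulrC -deltaE.
Qed.

(** A fixed vector of size [O(1 / l)] is zero. *)
Lemma vanish_of_decay (v : E) (M L : R) :
  (forall l, L < l -> (l - L) * nrm v <= M) -> v = 0.
Proof.
move=> vM; apply: nrm_eq0; apply/eqP; rewrite eq_le nrm_ge0 andbT leNgt.
apply/negP => v0; have M0 : 0 <= M.
  by have := vM (L + 1) ltac:(lra); rewrite addrC addKr mul1r; apply: le_trans; exact: ltW.
have := vM (L + (M + 1) / nrm v).
rewrite ltrDl divr_gt0//; last lra.
by rewrite addrC addKr divfK ?gt_eqF// => /(_ isT); lra.
Qed.

(** Each [C A^n R x] tends to zero as [l] grows.  So [d = 0]; and whenever the two
    [C A^n R x] agree for all large [l], multiplying by [l] and letting [l] grow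
    shows first that the moments of order [n] agree, then that the
    [C A^(n+1) R x] agree. *)
Lemma moments_of_resolvents (rho : R) x x' d :
  (forall l : R, rho < l -> [/\ resolvent_set A l%:C%C, resolvent_set A' l%:C%C &
     d + C (resolvent A l%:C%C x) = C' (resolvent A' l%:C%C x')]) ->
  d = 0 /\ forall n, C (iter n A x) = C' (iter n A' x').
Proof.
move=> agree.
have [_ [c c0 Ac]] := (bounded_opP _).1 bA.
have [_ [c' c0' Ac']] := (bounded_opP _).1 bA'.
pose L := Num.max `|rho| (c + c').
have rhoL l : L < l -> rho < l.
  by rewrite gt_max => /andP[+ _]; apply: le_lt_trans; exact: ler_norm.
have decay n l : L < l -> (l - L) *
    nrm (C' (iter n A' (resolvent A' l%:C%C x')) - C (iter n A (resolvent A l%:C%C x)))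
    <= opnorm C' * (c' ^+ n * nrm x') + opnorm C * (c ^+ n * nrm x).
  move=> Ll; have [rl rl' _] := agree l (rhoL l Ll).
  have l0 : 0 < l by move: Ll; rewrite gt_max => /andP[+ _]; apply: le_lt_trans.
  have L0 : 0 <= l - L by rewrite subr_ge0 ltW.
  have cL : c + c' <= L by rewrite le_max lexx orbT.
  have h1 := resolvent_decay Ac rl x; have h1' := resolvent_decay Ac' rl' x'.
  rewrite nrmC gtr0_norm// in h1 h1'.
  rewrite (le_trans (ler_wpM2l L0 (nrmB _ _)))// mulrDr lerD//.
  - rewrite (le_trans (ler_wpM2l L0 (opnorm_le bC' _)))// mulrCA.
    rewrite ler_wpM2l ?opnorm_ge0//.
    rewrite (le_trans (ler_wpM2l L0 (nrm_iter_le _ _ c0' Ac')))// mulrCA.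
    rewrite ler_wpM2l ?exprn_ge0// (le_trans _ h1')// ler_wpM2r ?nrm_ge0//.
    by lra.
  - rewrite (le_trans (ler_wpM2l L0 (opnorm_le bC _)))// mulrCA.
    rewrite ler_wpM2l ?opnorm_ge0//.
    rewrite (le_trans (ler_wpM2l L0 (nrm_iter_le _ _ c0 Ac)))// mulrCA.
    rewrite ler_wpM2l ?exprn_ge0// (le_trans _ h1)// ler_wpM2r ?nrm_ge0//.
    by lra.
have d0 : d = 0.
  apply: vanish_of_decay => l Ll; have [rl rl' E1] := agree l (rhoL l Ll).
  by have decay0 := decay 0%N l Ll; rewrite /= -E1 addrK in decay0; exact: decay0.
split=> //.
have eqn n : (forall l : R, L < l -> C (iter n A (resolvent A l%:C%C x)) =
                             C' (iter n A' (resolvent A' l%:C%C x'))) ->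
    C (iter n A x) = C' (iter n A' x').
  move=> En; apply/eqP; rewrite -subr_eq0; apply/eqP.
  apply: vanish_of_decay => l Ll; have [rl rl' _] := agree l (rhoL l Ll).
  have := congr1 (fun v => l%:C%C *: v) (En l Ll).
  rewrite !resolvent_moment_step// => sumE.
  suff -> : C (iter n A x) - C' (iter n A' x') =
      C' (iter n.+1 A' (resolvent A' l%:C%C x')) -
      C (iter n.+1 A (resolvent A l%:C%C x)) by exact: decay.
  by apply/eqP; rewrite subr_eq addrAC eq_sym subr_eq sumE addrC.
have agree_n n : forall l : R, L < l -> C (iter n A (resolvent A l%:C%C x)) =
                             C' (iter n A' (resolvent A' l%:C%C x')).
  elim: n => [|n IH] l Ll; have [rl rl' E1] := agree l (rhoL l Ll).
    by rewrite /= -E1 d0 add0r.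
  have := congr1 (fun v => l%:C%C *: v) (IH l Ll).
  by rewrite !resolvent_moment_step// (eqn n IH) => /addrI.
by move=> n; exact: eqn (agree_n n).
Qed.

End TwoRealizations.
End Resolvents.

(** * Transfer functions, moments and quasi-similarity *)

Section TransferFunctions.
Context {R : realType} {X : external_data R}.
Implicit Types V W : vessel R X.

Lemma sigma1_surj t (v : spEt X) : exists u, v = sigma1 X t u.
Proof.
by have [_ [S [_ _ SK]]] := sigma1_invertible _ X t; exists (S v); rewrite SK.
Qed.

(** [Dt = sigma1s D sigma1^-1] by the linkage condition. *)
Lemma vDt_eq V W : vD V = vD W -> vDt V = vDt W.
Proof.
move=> DVW; apply/funext => t; apply/funext => v.
have [u ->] := sigma1_surj t v.
by rewrite -!vessel_linkage1 DVW.
Qed.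

Lemma resolvent_set_transport V t s l :
  resolvent_set (vA V s) l -> resolvent_set (vA V t) l.
Proof.
move=> rl; have [bS KS SK] := resolventP rl; split.
  exact/bounded_op_resolvent_pencil/vA_bounded.
have pencilF a b x : l *: vF V a b x - vA V a (vF V a b x) =
    vF V a b (l *: x - vA V b x).
  rewrite (op_linearB (vF_bounded V a b).1) (op_linearZ (vF_bounded V a b).1).
  by rewrite vessel_Lax.
exists (vF V t s \o (resolvent (vA V s) l \o vF V s t)); split.
- apply: bounded_op_comp; first exact: vF_bounded.
  by apply: bounded_op_comp => //; exact: vF_bounded.
- by move=> x /=; rewrite -pencilF KS vF_comp vF_id.
- by move=> x /=; rewrite pencilF SK vF_comp vF_id.
Qed.

Lemma resolvent_transport V t s l : resolvent_set (vA V s) l ->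
  forall x, resolvent (vA V t) l x =
            vF V t s (resolvent (vA V s) l (vF V s t x)).
Proof.
move=> rl x; apply: resolvent_uniq; first exact: resolvent_set_transport rl.
rewrite -vessel_Lax -(op_linearZ (vF_bounded V t s).1).
rewrite -(op_linearB (vF_bounded V t s).1).
by have [_ _ ->] := resolventP rl; rewrite vF_comp vF_id.
Qed.

(** Real [lambda] are enough; invertibility of [sigma1] allows to cancel it. *)
Lemma moments_of_transfer_functions V W :
  transfer_functions_agree_near_infinity V W ->
  vD V = vD W /\ forall t k v,
    vC V t (iter k (vA V t) (vB V t v)) = vC W t (iter k (vA W t) (vB W t v)).
Proof.
move=> [rho agree].
have H t u : vD V t u - vD W t u = 0 /\ forall k,
    vC V t (iter k (vA V t) (vB V t (sigma1 X t u))) =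
    vC W t (iter k (vA W t) (vB W t (sigma1 X t u))).
  apply: (moments_of_resolvents (vA_bounded _ _ V t) (vA_bounded _ _ W t)
    (vC_bounded _ _ V t) (vC_bounded _ _ W t) (rho := rho)) => l rl.
  have [|r r' /(congr1 (@^~ u))] := agree l%:C%C _ t.
    by rewrite nrmE nrmC ltcR (lt_le_trans rl)// ler_norm.
  rewrite /transfer_function => E1; split=> //.
  by rewrite addrAC E1 addrAC subrr add0r.
split=> [|t k v].
  apply/funext => t; apply/funext => u.
  by apply/eqP; rewrite -subr_eq0; apply/eqP; have [] := H t u.
by have [u ->] := sigma1_surj t v; have [_] := H t u.
Qed.

(** Everything is moved to time 0 by [F], so that the norms of the two operators
    [A(0)] give a radius that does not depend on [t]. *)
Lemma transfer_functions_of_moments V W :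
  vD V = vD W ->
  (forall t k v,
    vC V t (iter k (vA V t) (vB V t v)) = vC W t (iter k (vA W t) (vB W t v))) ->
  transfer_functions_agree_near_infinity V W.
Proof.
move=> DVW mom.
have [_ [c c0 Ac]] := (bounded_opP _).1 (vA_bounded _ _ V 0).
have [_ [c' c0' Ac']] := (bounded_opP _).1 (vA_bounded _ _ W 0).
exists (c + c') => l; rewrite nrmE ltcR => cl t.
have rl : resolvent_set (vA V 0) l.
  by apply: (resolvent_set_large (vA_bounded _ _ V 0) c0 Ac); lra.
have rl' : resolvent_set (vA W 0) l.
  by apply: (resolvent_set_large (vA_bounded _ _ W 0) c0' Ac'); lra.
split; [exact: resolvent_set_transport rl|exact: resolvent_set_transport rl'|].
apply/funext => u; rewrite /transfer_function DVW; congr (_ + _).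
rewrite (resolvent_transport rl) (resolvent_transport rl').
apply: (resolvents_of_moments (vA_bounded _ _ V 0) (vA_bounded _ _ W 0)
  (bounded_op_CF V t 0) (bounded_op_CF W t 0) (c := c + c')) => //.
- exact: addr_ge0.
- by move=> y; rewrite (le_trans (Ac y))// ler_wpM2r ?nrm_ge0// lerDl.
- by move=> y; rewrite (le_trans (Ac' y))// ler_wpM2r ?nrm_ge0// lerDr.
- by move=> k; rewrite !vA_iter !vF_comp !vF_id mom.
Qed.

Lemma moments_of_gauge_quasi_similar V W : gauge_quasi_similar V W ->
  forall t k v,
    vC V t (iter k (vA V t) (vB V t v)) = vC W t (iter k (vA W t) (vB W t v)).
Proof.
move=> [_ _ [dom [T [_ TA _ TB TC]]]] t k v.
have [ctrl TBt] := TB t.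
have domB : dom t (vB V t v).
  apply: ctrl; exists 1%N, (fun=> 1), (fun=> vB V t v); split.
    by move=> _; exists 0%N, t, v; rewrite /= vF_id.
  by rewrite big_ord1 scale1r.
have [domk Tk] : dom t (iter k (vA V t) (vB V t v)) /\
    iter k (vA W t) (vB W t v) = T t (iter k (vA V t) (vB V t v)).
  elim: k => [|k [IHd IHT]] /=; first by rewrite TBt.
  by have [? <-] := TA _ _ IHd; rewrite IHT.
by rewrite Tk TC.
Qed.

End TransferFunctions.

Section QuasiSimilarity.
Context {R : realType} {X : external_data R} {V W : vessel R X}.

(** The graph of the quasi-similarity: states at time [t] that produce the same
    outputs at all times.  Taking the largest possible graph avoids checking that
    a map defined on linear combinations of generators is well defined. *)
Definition indistinguishable t (x : vH V t) (y : vH W t) : Prop :=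
  forall k s, vC W s (iter k (vA W s) (vF W s t y)) =
              vC V s (iter k (vA V s) (vF V s t x)).

Lemma indistinguishable_linear t a x x' y y' :
  @indistinguishable t x y -> @indistinguishable t x' y' ->
  @indistinguishable t (a *: x + x') (a *: y + y').
Proof.
move=> xy xy' k s; have lV := (vF_bounded V s t).1; have lW := (vF_bounded W s t).1.
have lAV : linear (iter k (vA V s)).
  by apply: iter_linear; have [] := vA_bounded _ _ V s.
have lAW : linear (iter k (vA W s)).
  by apply: iter_linear; have [] := vA_bounded _ _ W s.
have [lCV _] := vC_bounded _ _ V s; have [lCW _] := vC_bounded _ _ W s.
by rewrite lV lW lAV lAW lCV lCW xy xy'.
Qed.

Lemma indistinguishable0 t : @indistinguishable t 0 0.
Proof.
move=> k s; have lV := (vF_bounded V s t).1; have lW := (vF_bounded W s t).1.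
have lAV : linear (iter k (vA V s)).
  by apply: iter_linear; have [] := vA_bounded _ _ V s.
have lAW : linear (iter k (vA W s)).
  by apply: iter_linear; have [] := vA_bounded _ _ W s.
have [lCV _] := vC_bounded _ _ V s; have [lCW _] := vC_bounded _ _ W s.
by rewrite !op_linear0.
Qed.

Lemma indistinguishable_vA t x y :
  @indistinguishable t x y -> @indistinguishable t (vA V t x) (vA W t y).
Proof.
by move=> xy k s; rewrite !vessel_Lax -!iterSr; exact: xy.
Qed.

Lemma indistinguishable_vF s t x y :
  @indistinguishable t x y -> @indistinguishable s (vF V s t x) (vF W s t y).
Proof. by move=> xy k r; rewrite !vF_comp; exact: xy. Qed.

(** Indistinguishability of corresponding generators of the controllable spaces is
    equality of the output functions with two time variables. *)
Lemma indistinguishable_controllable t j s v :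
  (forall t k u,
    vC V t (iter k (vA V t) (vB V t u)) = vC W t (iter k (vA W t) (vB W t u))) ->
  @indistinguishable t (vF V t s (iter j (vA V s) (vB V s v)))
                       (vF W t s (iter j (vA W s) (vB W s v))).
Proof.
move=> mom k r; rewrite !vF_comp !vA_iter -!iterD.
by apply/esym; apply: two_point_moments => i; exact: mom.
Qed.

Lemma indistinguishable_linear_span t (S : set (vH V t)) (S' : set (vH W t)) :
  (forall x, S x -> exists2 y, S' y & @indistinguishable t x y) ->
  forall x, linear_span S x ->
    exists2 y, linear_span S' y & @indistinguishable t x y.
Proof.
move=> SS' x [n [a [v [Sv ->]]]].
have /choice[w Hw] : forall i, exists y, S' y /\ @indistinguishable t (v i) y.
  by move=> i; have [y ? ?] := SS' _ (Sv i); exists y.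
exists (\sum_(i < n) a i *: w i).
  by exists n, a, w; split=> // i; have [] := Hw i.
elim/big_rec2: _ => [|i y x' _ H]; first exact: indistinguishable0.
by apply: indistinguishable_linear => //; have [] := Hw i.
Qed.

Lemma indistinguishable_uniq t x y y' : observable W ->
  @indistinguishable t x y -> @indistinguishable t x y' -> y = y'.
Proof.
move=> obs xy xy'; apply/eqP; rewrite -subr_eq0; apply/eqP.
have : unobservable_space W t (y - y').
  move=> k s; rewrite (op_linearB (vF_bounded W s t).1).
  have lAW : linear (iter k (vA W s)).
    by apply: iter_linear; have [] := vA_bounded _ _ W s.
  have [lCW _] := vC_bounded _ _ W s.
  by rewrite (op_linearB lAW) (op_linearB lCW) xy xy' subrr.
by rewrite obs.
Qed.

End QuasiSimilarity.

Lemma indistinguishable_sym (R : realType) (X : external_data R)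
    (V W : vessel R X) t x y :
  @indistinguishable R X V W t x y -> @indistinguishable R X W V t y x.
Proof. by move=> xy k s; rewrite xy. Qed.

Lemma dense_sub (T : topologicalType) (A B : set T) :
  A `<=` B -> dense A -> dense B.
Proof.
move=> AB dA O O0 oO; have [x [Ox Ax]] := dA O O0 oO.
by exists x; split=> //; exact: AB.
Qed.

(** Observability of [W] makes [indistinguishable] a partial function and
    observability of [V] makes it injective.  Its domain and range contain the
    controllable spaces, which are dense. *)
Lemma gauge_quasi_similar_of_moments (R : realType) (X : external_data R)
    (V W : vessel R X) : minimal V -> minimal W -> vD V = vD W ->
  (forall t k u,
    vC V t (iter k (vA V t) (vB V t u)) = vC W t (iter k (vA W t) (vB W t u))) ->
  gauge_quasi_similar V W.
Proof.
move=> [ctrlV obsV] [ctrlW obsW] DVW mom.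
have mom' t k u :
    vC W t (iter k (vA W t) (vB W t u)) = vC V t (iter k (vA V t) (vB V t u)).
  by rewrite mom.
split=> //; first exact: vDt_eq.
pose ind := @indistinguishable R X V W.
pose dom t : set (vH V t) := [set x | exists y, ind t x y].
pose T t x : vH W t := xget 0 [set y | ind t x y].
have TP t x : dom t x -> ind t x (T t x) by move=> ?; exact: xgetPex.
have TE t x y : ind t x y -> T t x = y.
  move=> xy; apply: (indistinguishable_uniq obsW (x := x)) => //.
  by apply: TP; exists y.
have ctrl_dom t : controllable_space V t `<=` dom t.
  move=> x /(@indistinguishable_linear_span _ _ V W t _ (controllable_space W t)).
  case=> [_ [j [s [v ->]]]|y _ xy]; last by exists y.
  exists (vF W t s (iter j (vA W s) (vB W s v))).
    exists 1%N, (fun=> 1), (fun=> vF W t s (iter j (vA W s) (vB W s v))).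
    by split=> [_|]; [exists j, s, v|rewrite big_ord1 scale1r].
  exact: indistinguishable_controllable.
have ctrl_ran t : controllable_space W t `<=` T t @` dom t.
  move=> y /(@indistinguishable_linear_span _ _ W V t _ (controllable_space V t)).
  case=> [_ [j [s [v ->]]]|x _ /indistinguishable_sym xy].
    exists (vF V t s (iter j (vA V s) (vB V s v))).
      exists 1%N, (fun=> 1), (fun=> vF V t s (iter j (vA V s) (vB V s v))).
      by split=> [_|]; [exists j, s, v|rewrite big_ord1 scale1r].
    exact: indistinguishable_controllable.
  by exists x; [exists y|exact: TE].
exists dom, T; split.
- move=> t; split.
  + split=> [|a x y [x' xx'] [y' yy']]; first by exists 0; exact: indistinguishable0.
    by exists (a *: x' + y'); exact: indistinguishable_linear.
  + move=> a x y dx dy; apply: TE.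
    by apply: indistinguishable_linear; exact: TP.
  + exact: dense_sub (ctrl_dom t) (ctrlV t).
  + move=> x x' /set_mem dx /set_mem dx' Txx'.
    apply: (indistinguishable_uniq obsV (x := T t x)).
      by apply: indistinguishable_sym; exact: TP.
    by rewrite Txx'; apply: indistinguishable_sym; exact: TP.
  + exact: dense_sub (ctrl_ran t) (ctrlW t).
- move=> t x /TP/indistinguishable_vA xA.
  by split; [exists (vA W t (T t x))|rewrite (TE _ _ _ xA)].
- move=> t s x /TP/(indistinguishable_vF t) xF.
  by split; [exists (vF W t s (T s x))|rewrite (TE _ _ _ xF)].
- move=> t; split=> // v; apply/esym/TE.
  have := @indistinguishable_controllable R X V W t 0 t v mom.
  by rewrite /= !vF_id.
- by move=> t x /TP/(_ 0%N t); rewrite /= !vF_id.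
Qed.

Theorem theorem4p1 (R : realType) (X : external_data R) (V W : vessel R X)
    (minV : minimal V) (minW : minimal W) :
  gauge_quasi_similar V W <-> transfer_functions_agree_near_infinity V W.
Proof.
split=> [gqs|].
  apply: transfer_functions_of_moments; first by case: gqs.
  exact: moments_of_gauge_quasi_similar.
move=> /moments_of_transfer_functions[DVW mom].
exact: gauge_quasi_similar_of_moments.
Qed.
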